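(* Let $G$ be a connected, locally finite, quasi-transitive graph, and let $r>0$ be an integer. Then the $r$-local cover $G_r$ of $G$ is accessible.
   Context: A graph is quasi-transitive if its automorphism group has finitely many vertex orbits. Graphs may have loops and parallel edges and are viewed as 1-complexes; a cycle may be a loop or a pair of parallel edges; a closed walk once around a cycle $O$ traverses every edge of $O$ exactly once. $\pi_1^r(G,x_0)$ is the subgroup of $\pi_1(G,x_0)$ generated by the classes of closed walks $W_0QW_0^-$, $W_0$ a walk from $x_0$ to a vertex $y$, $Q$ a closed walk at $y$ once around a cycle of length at most $r$, $W_0^-$ the reverse of $W_0$. The $r$-local covering $p_r:G_r\to G$ is the connected normal covering with characteristic subgroup $\pi_1^r(G,x_0)$. A separation $\{A,B\}$ of a graph: $A\cup B$ is the vertex set and there is no edge between $A\setminus B$ and $B\setminus A$; its order is $|A\cap B|$. A finite-order separation distinguishes two ends if rays of one end have tails in $G[A]$ and rays of the other in $G[B]$. A graph is accessible if there is $K\in\mathbb{N}$ such that every two of its ends are distinguished by a separation of order at most $K$. *)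

(* Defs.v *)
(* Graphs with loops and parallel edges: a vertex type V, an
   edge type E and an endpoint map ends : E -> V * V (the orientation of an
   edge is an arbitrary choice; edges are undirected, loops have equal ends). *)
From Stdlib Require Import List Relations Arith ClassicalEpsilon.
Import ListNotations.
Set Implicit Arguments.

Section GraphDefs.
Context {V E : Type} (ends : E -> V * V).

Definition adj (u v : V) : Prop :=
  exists e, ends e = (u, v) \/ ends e = (v, u).

Definition incident (e : E) (v : V) : Prop :=
  fst (ends e) = v \/ snd (ends e) = v.

Definition locally_finite : Prop :=
  forall v, exists l : list E, forall e, incident e v -> In e l.

Definition dart : Type := (E * bool)%type.
Definition dtail (d : dart) : V :=
  if snd d then fst (ends (fst d)) else snd (ends (fst d)).
Definition dhead (d : dart) : V :=
  if snd d then snd (ends (fst d)) else fst (ends (fst d)).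
Definition drev (d : dart) : dart := (fst d, negb (snd d)).

Fixpoint is_walk (x : V) (l : list dart) : Prop :=
  match l with
  | [] => True
  | d :: l' => dtail d = x /\ is_walk (dhead d) l'
  end.
Fixpoint walk_end (x : V) (l : list dart) : V :=
  match l with
  | [] => x
  | d :: l' => walk_end (dhead d) l'
  end.

Definition connected : Prop :=
  forall u v, exists l, is_walk u l /\ walk_end u l = v.

Definition automorphism (fV : V -> V) (fE : E -> E) : Prop :=
  (exists gV : V -> V, forall v, gV (fV v) = v /\ fV (gV v) = v) /\
  (exists gE : E -> E, forall e, gE (fE e) = e /\ fE (gE e) = e) /\
  (forall e, ends (fE e) = (fV (fst (ends e)), fV (snd (ends e))) \/
             ends (fE e) = (fV (snd (ends e)), fV (fst (ends e)))).

Definition quasi_transitive : Prop :=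
  exists reps : list V, forall v, exists x fV fE,
    In x reps /\ automorphism fV fE /\ fV x = v.

(* Q is a closed walk at y once around a cycle of length at most r
   (a cycle: a loop, two parallel edges, or an ordinary cycle):
   nonempty, closed, pairwise distinct edges and pairwise distinct vertices *)
Definition once_around_cycle (r : nat) (y : V) (Q : list dart) : Prop :=
  Q <> [] /\ length Q <= r /\ is_walk y Q /\ walk_end y Q = y /\
  NoDup (map fst Q) /\ NoDup (map dtail Q).

(* elementary moves on walks from x0: deleting a backtrack d d^-, or deleting
   a closed walk once around a cycle of length <= r inserted at some point.
   The reflexive-symmetric-transitive closure identifies walks W, W' from x0
   iff they end at the same vertex and [W W'^-] lies in pi_1^r(G,x0). *)
Inductive rstep (r : nat) (x0 : V) : list dart -> list dart -> Prop :=
| rs_back : forall l1 l2 d,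
    is_walk x0 (l1 ++ d :: drev d :: l2) ->
    rstep r x0 (l1 ++ d :: drev d :: l2) (l1 ++ l2)
| rs_cyc : forall l1 l2 Q,
    is_walk x0 (l1 ++ Q ++ l2) ->
    once_around_cycle r (walk_end x0 l1) Q ->
    rstep r x0 (l1 ++ Q ++ l2) (l1 ++ l2).

Definition requiv (r : nat) (x0 : V) : relation (list dart) :=
  clos_refl_sym_trans _ (rstep r x0).

Lemma is_walk_app x l1 l2 :
  is_walk x l1 -> is_walk (walk_end x l1) l2 -> is_walk x (l1 ++ l2).
Proof.
  revert x; induction l1 as [|d l1 IH]; simpl; auto.
  intros x [H1 H2] H3; split; auto.
Qed.

Definition cover_V (r : nat) (x0 : V) : Type :=
  { P : list dart -> Prop | exists W, is_walk x0 W /\ P = requiv r x0 W }.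

Definition cover_rep_sig r x0 (q : cover_V r x0) :=
  constructive_indefinite_description _ (proj2_sig q).
Definition cover_rep r x0 (q : cover_V r x0) : list dart :=
  proj1_sig (cover_rep_sig q).
Lemma cover_rep_walk r x0 (q : cover_V r x0) : is_walk x0 (cover_rep q).
Proof. exact (proj1 (proj2_sig (cover_rep_sig q))). Qed.

Definition cover_cls r x0 (W : list dart) (H : is_walk x0 W) : cover_V r x0 :=
  exist _ (requiv r x0 W) (ex_intro _ W (conj H eq_refl)).

(* edges: the lift of an edge e starting (in its fst-to-snd orientation)
   at the lifted vertex q *)
Definition cover_E (r : nat) (x0 : V) : Type :=
  { p : cover_V r x0 * E | walk_end x0 (cover_rep (fst p)) = fst (ends (snd p)) }.

Lemma cover_edge_walk r x0 (p : cover_E r x0) :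
  is_walk x0 (cover_rep (fst (proj1_sig p)) ++ [(snd (proj1_sig p), true)]).
Proof.
  apply is_walk_app; [apply cover_rep_walk|].
  simpl; unfold dtail; simpl. split; [symmetry; exact (proj2_sig p)| exact I].
Qed.

Definition cover_ends (r : nat) (x0 : V) (p : cover_E r x0)
  : cover_V r x0 * cover_V r x0 :=
  (fst (proj1_sig p), @cover_cls r x0 _ (cover_edge_walk p)).

End GraphDefs.

Section Ends.
Context {V E : Type} (ends : E -> V * V).

Definition ray (f : nat -> V) : Prop :=
  (forall i j, f i = f j -> i = j) /\ (forall n, adj ends (f n) (f (S n))).

Definition conn_avoid (S : list V) : relation V :=
  clos_refl_trans _ (fun u v => adj ends u v /\ ~ In u S /\ ~ In v S).

Definition same_end (f g : nat -> V) : Prop :=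
  forall S : list V, exists i j,
    (forall k, i <= k -> ~ In (f k) S) /\ (forall k, j <= k -> ~ In (g k) S) /\
    conn_avoid S (f i) (g j).

Definition separation (A B : V -> Prop) : Prop :=
  (forall v, A v \/ B v) /\
  (forall u v, adj ends u v -> ~ (A u /\ ~ B u /\ B v /\ ~ A v)).

Definition order_le (A B : V -> Prop) (K : nat) : Prop :=
  exists l : list V, length l <= K /\ forall v, A v -> B v -> In v l.

Definition tail_in (f : nat -> V) (A : V -> Prop) : Prop :=
  exists i, forall k, i <= k -> A (f k).

Definition accessible : Prop :=
  exists K : nat, forall f g, ray f -> ray g -> ~ same_end f g ->
    exists A B : V -> Prop,
      separation A B /\ order_le A B K /\ tail_in f A /\ tail_in g B.

End Ends.

(* Main.v *)
(* Write [X] for the cover; it is locally finite and quasi-transitive because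
   automorphisms of [G] lift, and, as its closed walks are generated by lifts of
   short cycles, every mod 2 cocycle of [X] vanishing on short closed walks is a
   coboundary.  These properties alone imply accessibility, by a variant of
   Dunwoody's argument.

   For two distinct ends take, among the cuts of minimal size between them, one
   that crosses as few other minimal cuts (of size at most [K]) as possible.
   By submodularity these optimal cuts are pairwise nested, and they are
   permuted by the automorphisms.  Let [A] be a predecessor of [B] among them
   whose boundary shares an edge with that of [B].  The shared part of the two
   boundaries is not a coboundary, since [B] and the complement of [A] are
   connected and overlap; but it would be a cocycle vanishing on every short
   closed walk unless one of these walks meets [A], [B \ A] and the complement
   of [B], in [u], [w] and [v] say.  Then [B] is the least optimal cut that
   contains [u] and [w] but not [v].  Hence the number of sizes of optimal cuts
   is at most the number of orbits of such triples, which does not depend on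
   [K]; the sizes of minimal cuts are therefore bounded. *)
Require Import Defs.
From Stdlib Require Import List Relations Arith Lia Bool.
From Stdlib Require Import Classical ClassicalEpsilon FunctionalExtensionality.
From Stdlib Require Import PropExtensionality ProofIrrelevance.
Import ListNotations.
Set Implicit Arguments.

(** * Finite predicates and their cardinality *)

Lemma pred_ext {T} (P Q : T -> Prop) : (forall x, P x <-> Q x) -> P = Q.
Proof.
  intros H; apply functional_extensionality; intros x.
  apply propositional_extensionality; auto.
Qed.

Definition complement {T} (A : T -> Prop) : T -> Prop := fun x => ~ A x.

Lemma complement_involutive {T} (A : T -> Prop) : complement (complement A) = A.
Proof. apply pred_ext; intros x; unfold complement; tauto. Qed.

Definition finite {T} (P : T -> Prop) := exists l, forall x, P x -> In x l.

Lemma finite_subset {T} (P Q : T -> Prop) :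
  finite Q -> (forall x, P x -> Q x) -> finite P.
Proof. intros [l H] H'; exists l; auto. Qed.

Lemma finite_or {T} (P Q : T -> Prop) :
  finite P -> finite Q -> finite (fun x => P x \/ Q x).
Proof.
  intros [l H] [l' H']; exists (l ++ l'); intros x [Hx|Hx]; apply in_or_app; auto.
Qed.

Lemma finite_exists_list {T I} (l : list I) (Q : I -> T -> Prop) :
  (forall i, In i l -> finite (Q i)) ->
  finite (fun x => exists i, In i l /\ Q i x).
Proof.
  induction l as [|i l IH]; intros H.
  - exists []; intros x [i [[] _]].
  - eapply finite_subset.
    + apply finite_or; [apply (H i); left; auto|].
      apply IH; intros j Hj; apply H; right; auto.
    + intros x [j [[<-|Hj] Hx]]; [left; auto|right; eauto].
Qed.

Lemma finite_exists {T I} (P : I -> Prop) (Q : I -> T -> Prop) :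
  finite P -> (forall i, P i -> finite (Q i)) ->
  finite (fun x => exists i, P i /\ Q i x).
Proof.
  intros [l H] HQ.
  eapply finite_subset with (Q := fun x => exists i, In i l /\ (P i /\ Q i x)).
  - apply finite_exists_list; intros i _.
    destruct (classic (P i)) as [Hi|Hi].
    + eapply finite_subset; [apply (HQ i Hi)|tauto].
    + exists []; tauto.
  - intros x [i [Hi Hx]]; exists i; auto.
Qed.

Lemma finite_image {T U} (f : T -> U) (P : T -> Prop) :
  finite P -> finite (fun y => exists x, P x /\ f x = y).
Proof.
  intros HP; apply finite_exists; auto.
  intros x _; exists [f x]; intros y <-; left; auto.
Qed.

Lemma finite_maximal {T} (P : T -> Prop) (lt : T -> T -> Prop) :
  (forall x, ~ lt x x) -> (forall x y z, lt x y -> lt y z -> lt x z) ->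
  finite P -> (exists x, P x) -> exists x, P x /\ forall y, P y -> ~ lt x y.
Proof.
  intros Hirr Htr [l Hl] Hex.
  assert (H : (exists x, P x /\ In x l) ->
              exists x, P x /\ forall y, P y -> In y l -> ~ lt x y).
  { clear Hl Hex; induction l as [|a l IH]; intros [x [Hx Hin]]; [destruct Hin|].
    destruct (classic (P a)) as [Ha|Ha].
    - destruct (classic (exists y, P y /\ In y l /\ lt a y)) as [[y [Hy [Hyl Hay]]]|Hn].
      + destruct IH as [z [Hz Hm]]; [eauto|].
        destruct (classic (lt z a)) as [Hza|Hza].
        * exfalso; apply (Hm y); eauto.
        * exists z; split; auto; intros w Hw [<-|Hwl]; auto.
      + exists a; split; auto; intros y Hy [<-|Hyl]; [apply Hirr|].
        intros Hay; apply Hn; eauto.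
    - destruct IH as [z [Hz Hm]].
      + destruct Hin as [<-|Hin]; [tauto|eauto].
      + exists z; split; auto; intros w Hw [<-|Hwl]; auto. }
  destruct Hex as [x0 Hx0].
  destruct H as [x [Hx Hm]]; [eauto|].
  exists x; split; auto.
Qed.

Definition dec (P : Prop) : bool := if excluded_middle_informative P then true else false.

Lemma dec_true (P : Prop) : dec P = true <-> P.
Proof. unfold dec; destruct excluded_middle_informative; split; congruence || tauto. Qed.

Lemma dec_iff (P Q : Prop) : (P <-> Q) -> dec P = dec Q.
Proof.
  unfold dec; do 2 destruct excluded_middle_informative; tauto.
Qed.

(** Choosing the list by [epsilon] makes [card] a total function of the predicate. On an infinite
    predicate its value is unspecified, so comparisons of cardinalities ask for finiteness. *)
Definition enum {T} (P : T -> Prop) : list T :=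
  epsilon (inhabits []) (fun l => NoDup l /\ forall x, In x l <-> P x).

Definition card {T} (P : T -> Prop) : nat := length (enum P).

Definition ind (P : Prop) : nat := if excluded_middle_informative P then 1 else 0.

Section Card.
Context {T : Type}.
Implicit Types P Q : T -> Prop.

Lemma finite_nodup P : finite P -> exists l, NoDup l /\ forall x, In x l <-> P x.
Proof.
  intros [l H].
  exists (nodup (fun x y => excluded_middle_informative (x = y)) (filter (fun x => dec (P x)) l)).
  split; [apply NoDup_nodup|].
  intros x; rewrite nodup_In, filter_In, dec_true; split; [tauto|auto].
Qed.

Lemma enum_spec P : finite P -> NoDup (enum P) /\ forall x, In x (enum P) <-> P x.
Proof. intros H; unfold enum; apply epsilon_spec, finite_nodup, H. Qed.

(** Sums of indicators over a common list reduce inequalities between cardinalities to pointwise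
    ones, as in the next lemmas. *)
Lemma card_sum P l :
  NoDup l -> (forall x, P x -> In x l) -> card P = list_sum (map (fun x => ind (P x)) l).
Proof.
  intros Hl HP.
  assert (Hf : length (filter (fun x => dec (P x)) l)
               = list_sum (map (fun x => ind (P x)) l)).
  { clear; induction l as [|a l IH]; simpl; auto.
    unfold ind at 1, dec at 1; destruct excluded_middle_informative; simpl; rewrite IH; auto. }
  rewrite <- Hf.
  destruct (@enum_spec P) as [Hn Hi]; [exists l; auto|].
  apply Nat.le_antisymm; apply NoDup_incl_length; auto using NoDup_filter.
  - intros x Hx; apply filter_In; rewrite dec_true; apply Hi in Hx; auto.
  - intros x Hx; apply filter_In in Hx; rewrite dec_true in Hx; apply Hi; tauto.
Qed.

Lemma cards_cover P Q :
  finite P -> finite Q ->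
  exists l, NoDup l /\ (forall x, P x -> In x l) /\ (forall x, Q x -> In x l).
Proof.
  intros HP HQ; destruct (finite_nodup (finite_or HP HQ)) as [l [Hn Hi]].
  exists l; repeat split; auto; intros; apply Hi; auto.
Qed.

Lemma card_add_le P1 P2 Q1 Q2 :
  finite Q1 -> finite Q2 ->
  (forall x, ind (P1 x) + ind (P2 x) <= ind (Q1 x) + ind (Q2 x)) ->
  card P1 + card P2 <= card Q1 + card Q2.
Proof.
  intros H1 H2 H; destruct (cards_cover H1 H2) as [l [Hn [Hl1 Hl2]]].
  assert (HP : forall x, P1 x \/ P2 x -> In x l).
  { intros x Hx; destruct (classic (Q1 x)); auto; destruct (classic (Q2 x)); auto.
    specialize (H x); unfold ind in H; repeat destruct excluded_middle_informative; tauto || lia. }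
  rewrite !(fun P => @card_sum P l Hn) by auto.
  clear - H; induction l as [|a l IH]; simpl; auto.
  specialize (H a); lia.
Qed.

Lemma card_add_lt P1 P2 Q1 Q2 x0 :
  finite Q1 -> finite Q2 ->
  (forall x, ind (P1 x) + ind (P2 x) <= ind (Q1 x) + ind (Q2 x)) ->
  ind (P1 x0) + ind (P2 x0) < ind (Q1 x0) + ind (Q2 x0) ->
  card P1 + card P2 < card Q1 + card Q2.
Proof.
  intros H1 H2 H H0; destruct (cards_cover H1 H2) as [l [Hn [Hl1 Hl2]]].
  assert (HP : forall x, P1 x \/ P2 x -> In x l).
  { intros x Hx; destruct (classic (Q1 x)); auto; destruct (classic (Q2 x)); auto.
    specialize (H x); unfold ind in H; repeat destruct excluded_middle_informative; tauto || lia. }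
  assert (Hx0 : In x0 l).
  { destruct (classic (Q1 x0)); auto; destruct (classic (Q2 x0)); auto.
    unfold ind in H0; repeat destruct excluded_middle_informative; tauto || lia. }
  destruct (in_split _ _ Hx0) as [la [lb ->]].
  rewrite !(fun P => @card_sum P (la ++ x0 :: lb) Hn) by auto.
  rewrite !map_app, !list_sum_app; simpl.
  assert (Hs : forall l, list_sum (map (fun x => ind (P1 x)) l) + list_sum (map (fun x => ind (P2 x)) l)
     <= list_sum (map (fun x => ind (Q1 x)) l) + list_sum (map (fun x => ind (Q2 x)) l)).
  { intros l; induction l as [|a l IH]; simpl; auto; specialize (H a); lia. }
  pose proof (Hs la); pose proof (Hs lb); lia.
Qed.

Lemma card_lt P Q x0 :
  finite Q -> (forall x, P x -> Q x) -> Q x0 -> ~ P x0 -> card P < card Q.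
Proof.
  intros HQ H H1 H2.
  (* Each predicate is taken twice, so that the two-term inequality applies. *)
  assert (card P + card P < card Q + card Q); [|lia].
  apply card_add_lt with x0; auto.
  - intros x; specialize (H x); unfold ind; repeat destruct excluded_middle_informative; tauto || lia.
  - unfold ind; repeat destruct excluded_middle_informative; tauto || lia.
Qed.
End Card.

Lemma card_inj_le {T U} (h : T -> U) (P : T -> Prop) (Q : U -> Prop) :
  (forall x y, h x = h y -> x = y) -> finite P -> finite Q ->
  (forall x, P x -> Q (h x)) -> card P <= card Q.
Proof.
  intros Hinj HP HQ H; unfold card.
  destruct (enum_spec HP) as [Hn Hi], (enum_spec HQ) as [_ Hi'].
  rewrite <- (length_map h); apply NoDup_incl_length.
  - apply NoDup_map_NoDup_ForallPairs; auto; intros x y _ _; apply Hinj.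
  - intros y Hy; apply in_map_iff in Hy; destruct Hy as [x [<- Hx]].
    apply Hi', H, Hi, Hx.
Qed.

Lemma card_bij {T U} (h : T -> U) (k : U -> T) (P : T -> Prop) (Q : U -> Prop) :
  (forall x, k (h x) = x) -> (forall y, h (k y) = y) -> finite Q ->
  (forall x, P x <-> Q (h x)) -> finite P /\ card P = card Q.
Proof.
  intros Hk Hh HQ H.
  assert (HP : finite P).
  { eapply finite_subset; [apply (finite_image k HQ)|].
    intros x Hx; exists (h x); split; auto; apply H; auto. }
  split; auto; apply Nat.le_antisymm.
  - apply card_inj_le with h; auto; [|intros; apply H; auto].
    intros x y E; rewrite <- (Hk x), <- (Hk y), E; auto.
  - apply card_inj_le with k; auto.
    + intros x y E; rewrite <- (Hh x), <- (Hh y), E; auto.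
    + intros y Hy; apply H; rewrite Hh; auto.
Qed.

(** An unbounded set of numbers contains arbitrarily long lists without repetition, since an element
    above the current maximum can always be added. Later a bound on how many cut sizes occur becomes
    a bound on the sizes. *)
Lemma bounded_of_nodup_length (S : nat -> Prop) N :
  (forall l, NoDup l -> (forall s, In s l -> S s) -> length l <= N) ->
  exists K, forall s, S s -> s <= K.
Proof.
  intros H; apply NNPP; intros Hn.
  assert (Hbig : forall K, exists s, S s /\ K < s).
  { intros K; apply NNPP; intros HK; apply Hn; exists K; intros s Hs.
    destruct (le_lt_dec s K); auto; exfalso; eauto. }
  assert (Hl : forall n, exists l, NoDup l /\ (forall s, In s l -> S s) /\ length l = n).
  { intros n; induction n as [|n [l [H1 [H2 H3]]]].
    - exists []; repeat split; [constructor|intros s []].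
    - destruct (Hbig (list_max l)) as [s [Hs Hlt]].
      exists (s :: l); repeat split; simpl; auto.
      + constructor; auto; intros Hin.
        pose proof (proj1 (list_max_le l (list_max l)) (le_n _)) as Hm.
        rewrite Forall_forall in Hm; specialize (Hm _ Hin); lia.
      + intros t [<-|Ht]; auto. }
  destruct (Hl (Datatypes.S N)) as [l [H1 [H2 H3]]]; specialize (H l H1 H2); lia.
Qed.

Lemma pigeonhole_rel {T} (R : T -> nat -> Prop) (L : list T) (ss : list nat) :
  NoDup ss -> (forall s, In s ss -> exists x, In x L /\ R x s) ->
  (forall x s t, R x s -> R x t -> s = t) -> length ss <= length L.
Proof.
  intros Hn H Hf.
  (* A nonempty [ss] supplies an element of [T], which the choice function [f] needs as its
     default. *)
  destruct ss as [|s0 ss']; [simpl; lia|set (ss := s0 :: ss') in *].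
  destruct (H s0) as [t0 _]; [left; auto|].
  pose (f := fun s => epsilon (inhabits t0) (fun x => In x L /\ R x s)).
  assert (Hs : forall s, In s ss -> In (f s) L /\ R (f s) s).
  { intros s Hs; apply (epsilon_spec (inhabits t0) _ (H s Hs)). }
  rewrite <- (length_map f); apply NoDup_incl_length.
  - apply NoDup_map_NoDup_ForallPairs; auto.
    intros s t Hs1 Ht1 E; apply (Hf (f s)); [apply Hs; auto|rewrite E; apply Hs; auto].
  - intros x Hx; apply in_map_iff in Hx; destruct Hx as [s [<- Hs1]]; apply Hs; auto.
Qed.

(** * Tight cuts *)

(* Every edge of the cut occurs as two ordered pairs, so that a set and its
   complement have literally the same boundary. *)
Definition boundary {V} (R : V -> V -> Prop) (A : V -> Prop) : V * V -> Prop :=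
  fun p => R (fst p) (snd p) /\ (A (fst p) <-> ~ A (snd p)).

Definition connected_in {V} (R : V -> V -> Prop) (A : V -> Prop) : Prop :=
  forall u v, A u -> A v -> clos_refl_trans V (fun a b => R a b /\ A a /\ A b) u v.

Definition tight {V} (R : V -> V -> Prop) (A : V -> Prop) : Prop :=
  connected_in R A /\ connected_in R (complement A).

Lemma boundary_complement {V} (R : V -> V -> Prop) A :
  boundary R (complement A) = boundary R A.
Proof. apply pred_ext; intros [u v]; unfold boundary, complement; simpl; tauto. Qed.

Lemma crt_impl {V} (R S : V -> V -> Prop) u v :
  (forall a b, R a b -> S a b) -> clos_refl_trans V R u v -> clos_refl_trans V S u v.
Proof.
  intros H; induction 1; [apply rt_step; auto|apply rt_refl|eapply rt_trans; eauto].
Qed.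

Lemma crt_sym {V} (R : V -> V -> Prop) u v :
  (forall a b, R a b -> R b a) -> clos_refl_trans V R u v -> clos_refl_trans V R v u.
Proof.
  intros H; induction 1; [apply rt_step; auto|apply rt_refl|eapply rt_trans; eauto].
Qed.

Lemma crt_invariant {V} (R : V -> V -> Prop) (Q : V -> Prop) u v :
  (forall a b, R a b -> Q a -> Q b) -> clos_refl_trans V R u v -> Q u -> Q v.
Proof. intros H; induction 1; eauto. Qed.

(** The pairs along one path from [u] to [v] serve all sets [A] at once. This uniformity yields
    finite lists of edges that every cut of a given kind must use. *)
Lemma crt_cross {V} (R : V -> V -> Prop) u v :
  clos_refl_trans V R u v ->
  exists l, (forall p, In p l -> R (fst p) (snd p)) /\
    forall A : V -> Prop, A u -> ~ A v -> exists p, In p l /\ A (fst p) /\ ~ A (snd p).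
Proof.
  induction 1 as [u v H|u|u w v _ [l1 [H1 C1]] _ [l2 [H2 C2]]].
  - exists [(u, v)]; split.
    + intros p [<-|[]]; auto.
    + intros A Hu Hv; exists (u, v); simpl; auto.
  - exists []; split; [intros p []|tauto].
  - exists (l1 ++ l2); split.
    + intros p Hp; apply in_app_or in Hp; destruct Hp; auto.
    + intros A Hu Hv; destruct (classic (A w)) as [Hw|Hw].
      * destruct (C2 A Hw Hv) as [p [Hp Hc]]; exists p; split; auto; apply in_or_app; auto.
      * destruct (C1 A Hu Hw) as [p [Hp Hc]]; exists p; split; auto; apply in_or_app; auto.
Qed.

(* Induction on [k]: after deleting the edge [xy], either [A] is forced to be
   the component of [x], or a fixed path from [x] to [y] contains a boundary
   edge of [A] and the boundary has become smaller. *)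
Lemma finite_tight_through_edge {V} k : forall (R : V -> V -> Prop) x y,
  (forall a b, R a b -> R b a) -> R x y ->
  finite (fun A : V -> Prop => A x /\ ~ A y /\ tight R A /\
            exists l, length l <= k /\ forall p, boundary R A p -> In p l).
Proof.
  induction k as [|k IH]; intros R x y Rsym Rxy.
  { exists []; intros A [Hx [Hy [_ [l [Hl Hb]]]]].
    destruct l; simpl in Hl; [|lia].
    apply (Hb (x, y)); unfold boundary; simpl; tauto. }
  set (R' := fun a b => R a b /\ ~ (a = x /\ b = y) /\ ~ (a = y /\ b = x)).
  assert (R'sym : forall a b, R' a b -> R' b a) by (unfold R'; intuition).
  (* A set separating [x] from [y] keeps all its inner edges, and those of its complement, when [xy]
     is deleted. *)
  assert (Hin : forall A : V -> Prop, A x -> ~ A y -> forall a b,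
            R a b /\ (A a <-> A b) -> R' a b).
  { intros A Hx Hy a b [Hab Hi]; split; auto.
    split; intros [-> ->]; tauto. }
  destruct (classic (clos_refl_trans V R' x y)) as [Hp|Hp].
  - destruct (crt_cross Hp) as [l [Hl Hc]].
    eapply finite_subset; [apply finite_exists_list with (l := l)
      (Q := fun p A => A (fst p) /\ ~ A (snd p) /\ tight R' A /\
            exists l, length l <= k /\ forall p, boundary R' A p -> In p l)|].
    + intros [a b] Hab; apply IH; auto; apply (Hl (a, b) Hab).
    + intros A [Hx [Hy [[Hc1 Hc2] [m [Hm Hb]]]]].
      destruct (Hc A Hx Hy) as [p [Hpl [Hp1 Hp2]]].
      exists p; repeat split; auto.
      * intros u v Hu Hv; eapply crt_impl; [|apply (Hc1 u v Hu Hv)].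
        simpl; intros a b [Hab [Ha Hb']]; split; auto; apply (Hin A); auto; tauto.
      * intros u v Hu Hv; eapply crt_impl; [|apply (Hc2 u v Hu Hv)].
        unfold complement; simpl; intros a b [Hab [Ha Hb']]; split; auto; apply (Hin A); auto; tauto.
      (* The pair [(x, y)] is in the boundary for [R] but not for [R']; dropping it from the list
         lowers the bound from [S k] to [k]. *)
      * assert (Hxy : In (x, y) m) by (apply Hb; unfold boundary; simpl; tauto).
        destruct (in_split _ _ Hxy) as [m1 [m2 ->]].
        exists (m1 ++ m2); split; [rewrite length_app in *; simpl in Hm; lia|].
        intros q [[Hq [Hq1 Hq2]] Hq3].
        assert (Hq' : In q (m1 ++ (x, y) :: m2)) by (apply Hb; split; auto).
        apply in_app_or in Hq'; apply in_or_app; destruct Hq' as [|[<-|]]; auto.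
        simpl in *; tauto.
  - exists [clos_refl_trans V R' x]; intros A [Hx [Hy [[Hc1 Hc2] _]]]; left.
    apply pred_ext; intros v; split.
    + intros Hv; apply NNPP; intros Hnv; apply Hp.
      apply rt_trans with v; auto.
      eapply crt_impl; [|apply (Hc2 v y Hnv Hy)].
      unfold complement; simpl; intros a b Hab; apply (Hin A); tauto.
    + intros Hv; eapply crt_impl; [|apply (Hc1 x v Hx Hv)].
      simpl; intros a b Hab; apply (Hin A); tauto.
Qed.

(** * Nested and crossing sets *)

Definition nested {V} (A B : V -> Prop) : Prop :=
  (forall v, ~ (A v /\ B v)) \/ (forall v, ~ (A v /\ ~ B v)) \/
  (forall v, ~ (~ A v /\ B v)) \/ (forall v, ~ (~ A v /\ ~ B v)).

Lemma nested_complement_l {V} (A B : V -> Prop) : nested (complement A) B <-> nested A B.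
Proof.
  unfold nested, complement; split; (intros [H|[H|[H|H]]]; [right; right; left|right; right; right|left|right; left]);
    intros v; specialize (H v); tauto.
Qed.

Lemma nested_sym {V} (A B : V -> Prop) : nested A B -> nested B A.
Proof.
  intros [H|[H|[H|H]]]; [left|right; right; left|right; left|right; right; right];
    intros v; specialize (H v); tauto.
Qed.

Lemma nested_complement_r {V} (A B : V -> Prop) : nested A (complement B) <-> nested A B.
Proof. split; intros H; apply nested_sym, nested_complement_l, nested_sym, H. Qed.

Lemma nested_refl {V} (A : V -> Prop) : nested A A.
Proof. right; left; tauto. Qed.

Section Crossing.
Context {V : Type} (R : V -> V -> Prop).
Context (Rsym : forall a b, R a b -> R b a).
Context (Rconn : forall u v, clos_refl_trans V R u v).

Lemma crossing_edges (L : list (V * V)) :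
  exists l, (forall p, In p l -> R (fst p) (snd p)) /\
    forall (A : V -> Prop) q, In q L -> A (fst q) -> ~ A (snd q) ->
      exists p, In p l /\ A (fst p) /\ ~ A (snd p).
Proof.
  induction L as [|[u v] L [l [H1 H2]]].
  - exists []; split; [intros p []|intros A q []].
  - destruct (crt_cross (Rconn u v)) as [m [H3 H4]].
    exists (m ++ l); split.
    + intros p Hp; apply in_app_or in Hp; destruct Hp; auto.
    + intros A q [<-|Hq] Ha Hb; simpl in *.
      * destruct (H4 A Ha Hb) as [p [Hp Hc]]; exists p; split; auto; apply in_or_app; auto.
      * destruct (H2 A q Hq Ha Hb) as [p [Hp Hc]]; exists p; split; auto; apply in_or_app; auto.
Qed.

(** No edge inside the connected complement of [F] lies in the boundary of [A], so this complement
    is contained in [A] or disjoint from it. *)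
Lemma boundary_constant_nested (A F : V -> Prop) :
  tight R F ->
  (forall a b, boundary R A (a, b) -> F a /\ F b) -> nested A F.
Proof.
  intros [_ HF] H.
  assert (Hc : forall u v, ~ F u -> ~ F v -> A u -> A v).
  { intros u v Hu Hv; apply crt_invariant with (2 := HF u v Hu Hv).
    intros a b [Hab [Ha Hb]] HA; apply NNPP; intros HA'.
    apply Ha, (H a b); split; simpl; auto; tauto. }
  destruct (classic (exists u, ~ F u /\ A u)) as [[u [Hu HA]]|Hn].
  - right; right; right; intros v [Hv1 Hv2]; eauto.
  - right; left; intros v [Hv1 Hv2]; eauto.
Qed.

(** A tight set that crosses [A] must separate two endpoints of boundary edges of [A]. Fixed paths
    between these finitely many endpoints then contain an edge leaving [F], and each edge is left by
    only finitely many tight sets of bounded boundary. *)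
Lemma finite_not_nested (A : V -> Prop) k :
  finite (boundary R A) ->
  finite (fun F => tight R F /\ (exists l, length l <= k /\ forall p, boundary R F p -> In p l)
                   /\ ~ nested A F).
Proof.
  intros [l Hl].
  set (ends := map fst l ++ map snd l).
  destruct (crossing_edges (list_prod ends ends)) as [m [Hm Hc]].
  eapply finite_subset; [apply finite_exists_list with (l := m)
      (Q := fun p F => F (fst p) /\ ~ F (snd p) /\ tight R F /\
            exists l, length l <= k /\ forall p, boundary R F p -> In p l)|].
  - intros [a b] Hp; apply finite_tight_through_edge; auto; apply (Hm (a, b) Hp).
  - intros F [Ht [Hk Hn]].
    assert (He : forall a b, boundary R A (a, b) -> In a ends /\ In b ends).
    { intros a b Hab; apply Hl in Hab; split; apply in_or_app.
      - left; apply in_map_iff; exists (a, b); auto.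
      - right; apply in_map_iff; exists (a, b); auto. }
    destruct (classic (exists u v, In u ends /\ In v ends /\ F u /\ ~ F v))
      as [[u [v [Hu [Hv [HFu HFv]]]]]|Hcst].
    + destruct (Hc F (u, v)) as [p [Hp Hc']]; auto; [apply in_prod; auto|].
      exists p; tauto.
    + exfalso; apply Hn.
      destruct (classic (exists u, In u ends /\ F u)) as [[u [Hu HFu]]|Hnone].
      * apply boundary_constant_nested; auto.
        intros a b Hab; destruct (He a b Hab); split; apply NNPP; intros ?; apply Hcst; eauto 7.
      * apply nested_complement_r, boundary_constant_nested.
        -- destruct Ht; split; auto; rewrite complement_involutive; auto.
        -- intros a b Hab; destruct (He a b Hab); split; intros ?; apply Hnone; eauto.
Qed.
End Crossing.

(** * Optimal cuts are nested *)

Lemma adj_sym {V E} (ends : E -> V * V) u v : adj ends u v -> adj ends v u.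
Proof. intros [e H]; exists e; tauto. Qed.

Lemma injective_avoids_list {V} (f : nat -> V) (l : list V) :
  (forall i j, f i = f j -> i = j) -> exists i, forall k, i <= k -> ~ In (f k) l.
Proof.
  intros Hinj; induction l as [|a l [i Hi]]; [exists 0; auto|].
  destruct (classic (exists j, f j = a)) as [[j Hj]|Hn].
  - exists (max i (S j)); intros k Hk [Ha|Hin].
    + assert (k = j) by (apply Hinj; congruence); lia.
    + apply (Hi k); auto; lia.
  - exists i; intros k Hk [Ha|Hin]; [eauto|apply (Hi k); auto].
Qed.

Definition inter {V} (A B : V -> Prop) : V -> Prop := fun v => A v /\ B v.

Lemma tail_in_combine {V} (f : nat -> V) (A B P : V -> Prop) :
  tail_in f A -> tail_in f B -> (forall v, A v -> B v -> P v) -> tail_in f P.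
Proof.
  intros [i Hi] [j Hj] H; exists (max i j); intros k Hk; apply H; [apply Hi|apply Hj]; lia.
Qed.

Lemma tail_in_complement {V} (f : nat -> V) (A : V -> Prop) :
  tail_in f A -> ~ tail_in f (complement A).
Proof.
  intros [i Hi] [j Hj]; apply (Hj (max i j)); [lia|apply Hi; lia].
Qed.

Definition splits {V} (f g : nat -> V) (A : V -> Prop) : Prop :=
  (tail_in f A /\ tail_in g (complement A)) \/ (tail_in f (complement A) /\ tail_in g A).

Lemma splits_sym {V} (f g : nat -> V) A : splits f g A -> splits g f A.
Proof. unfold splits; tauto. Qed.

Lemma splits_complement {V} (f g : nat -> V) A : splits f g A -> splits f g (complement A).
Proof. unfold splits; rewrite complement_involutive; tauto. Qed.

Section Cuts.
Context {V E : Type} (ends : E -> V * V).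
Context (Hconn : forall u v, clos_refl_trans V (adj ends) u v).
Implicit Types (f g : nat -> V) (A B C D F : V -> Prop).

Notation bd := (boundary (adj ends)).
Notation "'rays' f g" := (ray ends f /\ ray ends g) (at level 10, f at level 9, g at level 9).

(** A ray visits each vertex at most once, so it eventually avoids the finitely many endpoints of
    the boundary and then never changes sides. *)
Lemma ray_tail f A : ray ends f -> finite (bd A) -> tail_in f A \/ tail_in f (complement A).
Proof.
  intros [Hinj Hadj] [l Hl].
  destruct (injective_avoids_list f (map fst l) Hinj) as [i Hi].
  assert (Hstep : forall k, i <= k -> (A (f k) <-> A (f (S k)))).
  { intros k Hk; apply NNPP; intros Hn; apply (Hi k Hk).
    apply in_map_iff; exists (f k, f (S k)); split; auto.
    apply Hl; split; simpl; [apply Hadj|tauto]. }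
  assert (Hall : forall n, A (f (n + i)) <-> A (f i)).
  { induction n as [|n IH]; simpl; [tauto|].
    rewrite <- IH; symmetry; apply Hstep; lia. }
  destruct (classic (A (f i))) as [Ha|Ha]; [left|right]; exists i; intros k Hk;
    replace k with (k - i + i) by lia; unfold complement; rewrite Hall; auto.
Qed.

(** Competitors must have a finite boundary, since [card] means nothing otherwise. Both orientations
    are allowed by [splits], so complements of minimal cuts are again minimal cuts. *)
Definition mincut f g A : Prop :=
  finite (bd A) /\ splits f g A /\
  forall B, finite (bd B) -> splits f g B -> card (bd A) <= card (bd B).

Lemma mincut_sym f g A : mincut f g A -> mincut g f A.
Proof.
  intros [H1 [H2 H3]]; repeat split; auto using splits_sym.
Qed.

Lemma mincut_complement f g A : mincut f g A -> mincut f g (complement A).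
Proof.
  unfold mincut; rewrite boundary_complement; intros [H1 [H2 H3]].
  repeat split; auto using splits_complement.
Qed.

Lemma mincut_card f g A B : mincut f g A -> mincut f g B -> card (bd A) = card (bd B).
Proof.
  intros [H1 [H2 H3]] [H4 [H5 H6]]; apply Nat.le_antisymm; auto.
Qed.

Lemma mincut_exists f g A :
  finite (bd A) -> splits f g A -> exists B, mincut f g B.
Proof.
  remember (card (bd A)) as n eqn:En; revert A En.
  induction n as [n IH] using lt_wf_ind; intros A -> HA Hs.
  destruct (classic (exists B, finite (bd B) /\ splits f g B /\ card (bd B) < card (bd A)))
    as [[B [HB [HsB Hlt]]]|Hn].
  - eapply IH; eauto.
  - exists A; repeat split; auto; intros B HB HsB.
    apply not_lt; intros Hlt; apply Hn; exists B; auto.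
Qed.

(** The component [B] of [A] that contains the tail of [f] still splits the two rays, and its
    boundary is part of that of [A]. If it were not all of [A], some boundary edge of [A] would
    start in [A] outside [B], and [B] would be a smaller cut. *)
Lemma mincut_connected_in f g A :
  ray ends f -> mincut f g A -> tail_in f A -> connected_in (adj ends) A.
Proof.
  intros [_ Hadj] [Hfin [Hs Hmin]] [i Hi].
  set (RA := fun a b => adj ends a b /\ A a /\ A b).
  set (B := clos_refl_trans V RA (f i)).
  assert (RAsym : forall a b, RA a b -> RA b a).
  { intros a b [H1 [H2 H3]]; split; auto using adj_sym. }
  assert (HBA : forall v, B v -> A v).
  { intros v Hv; apply crt_invariant with (2 := Hv); [intros a b Hab _; apply Hab|apply Hi; auto]. }
  assert (Hclosed : forall a b, adj ends a b -> B a -> A b -> B b).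
  { intros a b Hab Ha Hb; apply rt_trans with a; auto; apply rt_step; split; auto. }
  assert (Hbd : forall p, bd B p -> bd A p).
  { intros [a b] [Hab Hi']; split; auto; simpl in *.
    pose proof (HBA a); pose proof (HBA b); pose proof (Hclosed a b Hab).
    pose proof (Hclosed b a (adj_sym Hab)); tauto. }
  assert (HsB : splits f g B).
  { left; split.
    - exists i; intros k Hk; replace k with (k - i + i) by lia.
      induction (k - i) as [|n IH]; [apply rt_refl|].
      apply Hclosed with (f (n + i)); [apply Hadj|apply IH; lia|apply Hi; lia].
    - destruct Hs as [[_ Hg]|[Hf _]].
      + destruct Hg as [j Hj]; exists j; intros k Hk HB; apply (Hj k Hk); auto.
      + exfalso; apply (@tail_in_complement _ f A); auto; exists i; auto. }
  assert (HAB : forall v, A v -> B v).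
  { intros w Hw; apply NNPP; intros Hn.
    destruct (crt_cross (Hconn w (f i))) as [l [Hl Hc]].
    destruct (Hc (fun v => A v /\ ~ B v)) as [[a b] [Hp [[Ha Hna] Hb]]]; auto.
    { intros [_ H]; apply H, rt_refl. }
    apply Hl in Hp; simpl in *.
    (* The path leaves [A] minus [B] along [ab]; as this edge cannot enter [B], it leaves [A]. *)
    assert (HnB : ~ B b).
    { intros H; apply Hna; apply (Hclosed b a); auto using adj_sym. }
    assert (Hlt : card (bd B) < card (bd A)).
    { apply card_lt with (a, b); auto.
      - split; simpl; auto; tauto.
      - intros [_ H]; simpl in H; tauto. }
    assert (finite (bd B)) by (eapply finite_subset; eauto).
    specialize (Hmin B H HsB); lia. }
  intros u v Hu Hv; apply rt_trans with (f i); [apply crt_sym; auto|]; apply HAB; auto.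
Qed.

Lemma mincut_tight f g A : rays f g -> mincut f g A -> tight (adj ends) A.
Proof.
  intros [Hf Hg] HA; pose proof HA as [_ [[[H1 H2]|[H1 H2]] _]]; split.
  - apply mincut_connected_in with f g; auto.
  - apply mincut_connected_in with g f; auto using mincut_sym, mincut_complement.
  - apply mincut_connected_in with g f; auto using mincut_sym, mincut_complement.
  - apply mincut_connected_in with f g; auto using mincut_sym, mincut_complement.
Qed.

(** The rays vary while the size is bounded by [K]; the bound ensures that only finitely many
    members cross a given cut with finite boundary. *)
Definition cutfam (K : nat) F : Prop :=
  (exists f g, rays f g /\ mincut f g F) /\ card (bd F) <= K.

Lemma cutfam_tight K F : cutfam K F -> tight (adj ends) F.
Proof. intros [[f [g [Hr HF]]] _]; eapply mincut_tight; eauto. Qed.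

Lemma cutfam_finite K F : cutfam K F -> finite (bd F).
Proof. intros [[f [g [_ [H _]]]] _]; auto. Qed.

Lemma cutfam_cover K F :
  cutfam K F -> exists l, length l <= K /\ forall p, bd F p -> In p l.
Proof.
  intros H; exists (enum (bd F)); split; [apply (proj2 H)|].
  intros p; apply (enum_spec (cutfam_finite H)).
Qed.

Lemma finite_cutfam_through_edge K u v :
  adj ends u v -> finite (fun F => cutfam K F /\ F u /\ ~ F v).
Proof.
  intros Huv.
  eapply finite_subset; [apply (@finite_tight_through_edge _ K (adj ends) u v); auto using adj_sym|].
  simpl; intros F [HF [Hu Hv]].
  exact (conj Hu (conj Hv (conj (cutfam_tight HF) (cutfam_cover HF)))).
Qed.

Lemma finite_crossings K A :
  finite (bd A) -> finite (fun F => cutfam K F /\ ~ nested A F).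
Proof.
  intros HA.
  eapply finite_subset; [apply (@finite_not_nested _ (adj ends)) with (k := K) (A := A); auto using adj_sym|].
  simpl; intros F [HF Hn].
  exact (conj (cutfam_tight HF) (conj (cutfam_cover HF) Hn)).
Qed.

(** * Uncrossing by submodularity *)

Definition crossings (K : nat) A : nat := card (fun F => cutfam K F /\ ~ nested A F).

Lemma crossings_complement K A : crossings K (complement A) = crossings K A.
Proof.
  unfold crossings; f_equal; apply pred_ext; intros F.
  rewrite nested_complement_l; tauto.
Qed.

Lemma boundary_corners_finite C D :
  finite (bd C) -> finite (bd D) -> finite (bd (inter C D)).
Proof.
  intros HC HD; eapply finite_subset; [apply (finite_or HC HD)|].
  intros [u v]; unfold boundary, inter; simpl.
  destruct (classic (C u)), (classic (C v)); tauto.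
Qed.

(** This is submodularity of the edge boundary, checked separately for each ordered pair by the
    positions of its ends relative to [C] and [D]. *)
Lemma card_boundary_corners C D :
  finite (bd C) -> finite (bd D) ->
  card (bd (inter C D)) + card (bd (inter (complement C) (complement D)))
  <= card (bd C) + card (bd D).
Proof.
  intros HC HD; apply card_add_le; auto.
  intros [u v]; unfold boundary, inter, complement; simpl.
  destruct (classic (adj ends u v)) as [Huv|Huv].
  - destruct (classic (C u)), (classic (C v)), (classic (D u)), (classic (D v)); unfold ind;
      repeat destruct excluded_middle_informative; lia || tauto.
  - unfold ind; repeat destruct excluded_middle_informative; lia || tauto.
Qed.

(** Most combinations of empty corners carry over to [inter C D]. In the remaining ones [F] lies in
    one of [C], [D] and contains the complement of the other; then the complements of [C] and [D]
    are disjoint, contrary to crossing. *)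
Lemma nested_corners C D F :
  ~ nested C D -> nested C F -> nested D F -> nested (inter C D) F.
Proof.
  intros Hn HC HD; unfold nested, inter in *.
  destruct HC as [H|[H|[H|H]]].
  - left; intros v; specialize (H v); tauto.
  - right; left; intros v; specialize (H v); tauto.
  - destruct HD as [H'|[H'|[H'|H']]].
    + left; intros v; specialize (H' v); tauto.
    + right; left; intros v; specialize (H' v); tauto.
    + right; right; left; intros v; specialize (H v); specialize (H' v); tauto.
    + exfalso; apply Hn; right; right; right; intros v; specialize (H v); specialize (H' v); tauto.
  - destruct HD as [H'|[H'|[H'|H']]].
    + left; intros v; specialize (H' v); tauto.
    + right; left; intros v; specialize (H' v); tauto.
    + exfalso; apply Hn; right; right; right; intros v; specialize (H v); specialize (H' v); tauto.
    + right; right; right; intros v; specialize (H v); specialize (H' v); tauto.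
Qed.

(** If [C] lies in [F] or misses it, the same holds for the part of [C] in [D]; otherwise the
    complement of [C] lies in [F] or misses it, and this passes to the opposite corner. *)
Lemma nested_one_corner C D F :
  nested C F -> nested (inter C D) F \/ nested (inter (complement C) (complement D)) F.
Proof.
  unfold nested, inter, complement; intros [H|[H|[H|H]]].
  - left; left; intros v; specialize (H v); tauto.
  - left; right; left; intros v; specialize (H v); tauto.
  - right; left; intros v; specialize (H v); tauto.
  - right; right; left; intros v; specialize (H v); tauto.
Qed.

Lemma inter_comm A B : inter A B = inter B A.
Proof. apply pred_ext; unfold inter; tauto. Qed.

(** A member of the family nested with both sets is nested with both corners, and one nested with a
    single set is nested with at least one corner. Strictness comes from [D] itself, which crosses
    [C] but neither corner. *)
Lemma crossings_corners K C D :
  cutfam K C -> cutfam K D -> ~ nested C D ->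
  crossings K (inter C D) + crossings K (inter (complement C) (complement D))
  < crossings K C + crossings K D.
Proof.
  intros HC HD Hn.
  assert (Hn' : ~ nested (complement C) (complement D)).
  { rewrite nested_complement_l, nested_complement_r; auto. }
  apply card_add_lt with D; try (apply finite_crossings; eapply cutfam_finite; eauto).
  - intros F.
    pose proof (@nested_corners C D F Hn) as N1.
    pose proof (@nested_corners _ _ F Hn') as N2.
    rewrite !nested_complement_l in N2.
    pose proof (@nested_one_corner C D F) as N3.
    pose proof (@nested_one_corner D C F) as N4.
    rewrite (inter_comm D C), (inter_comm (complement D)) in N4.
    unfold ind; repeat destruct excluded_middle_informative; lia || tauto.
  - assert (N1 : nested (inter C D) D) by (right; left; unfold inter; tauto).
    assert (N2 : nested (inter (complement C) (complement D)) D)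
      by (left; unfold inter, complement; tauto).
    pose proof (nested_refl D).
    unfold ind; repeat destruct excluded_middle_informative; lia || tauto.
Qed.

Definition optimal (K : nat) f g A : Prop :=
  mincut f g A /\ forall B, mincut f g B -> crossings K A <= crossings K B.

Lemma optimal_complement K f g A : optimal K f g A -> optimal K f g (complement A).
Proof.
  intros [H1 H2]; split; auto using mincut_complement.
  intros B HB; rewrite crossings_complement; auto.
Qed.

Lemma optimal_sym K f g A : optimal K f g A -> optimal K g f A.
Proof. intros [H1 H2]; split; auto using mincut_sym. Qed.

Lemma optimal_exists K f g A : mincut f g A -> exists B, optimal K f g B.
Proof.
  remember (crossings K A) as n eqn:En; revert A En.
  induction n as [n IH] using lt_wf_ind; intros A -> HA.
  destruct (classic (exists B, mincut f g B /\ crossings K B < crossings K A))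
    as [[B [HB Hlt]]|Hn].
  - eapply IH; eauto.
  - exists A; split; auto; intros B HB.
    apply not_lt; intros Hlt; apply Hn; exists B; auto.
Qed.

Lemma mincut_of_card_le f g A B :
  mincut f g A -> finite (bd B) -> splits f g B -> card (bd B) <= card (bd A) -> mincut f g B.
Proof.
  intros [H1 [H2 H3]] HB Hs Hle; repeat split; auto.
  intros B' HB' Hs'; specialize (H3 B' HB' Hs'); lia.
Qed.

(** Submodularity and minimality force both opposite corners to be minimal cuts for their pairs of
    rays. Optimality of [C] and [D] then contradicts the strict drop in [crossings_corners]. *)
Lemma corner_exchange K f g f' g' C D :
  rays f g -> rays f' g' -> optimal K f g C -> optimal K f' g' D ->
  card (bd C) <= K -> card (bd D) <= K -> ~ nested C D ->
  splits f g (inter C D) -> splits f' g' (inter (complement C) (complement D)) -> False.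
Proof.
  intros Hr Hr' [HC HCo] [HD HDo] KC KD Hn S1 S2.
  assert (F1 := boundary_corners_finite (proj1 HC) (proj1 HD)).
  assert (F2 : finite (bd (inter (complement C) (complement D)))).
  { apply boundary_corners_finite; rewrite boundary_complement; [apply HC|apply HD]. }
  pose proof (card_boundary_corners (proj1 HC) (proj1 HD)) as Hsub.
  pose proof (proj2 (proj2 HC) _ F1 S1).
  pose proof (proj2 (proj2 HD) _ F2 S2).
  assert (M1 : mincut f g (inter C D)) by (apply mincut_of_card_le with C; auto; lia).
  assert (M2 : mincut f' g' (inter (complement C) (complement D)))
    by (apply mincut_of_card_le with D; auto; lia).
  pose proof (HCo _ M1); pose proof (HDo _ M2).
  assert (Hlt : crossings K (inter C D) + crossings K (inter (complement C) (complement D))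
                < crossings K C + crossings K D).
  { apply crossings_corners; auto; split; eauto. }
  lia.
Qed.

(* If every corner splits one of the two pairs, each diagonal pair of corners
   beats the average of [C] and [D], so both [C] and [D] would cross strictly
   less than the other. *)
Lemma diagonal_exchange K f g f' g' C D :
  rays f g -> rays f' g' -> optimal K f g C -> optimal K f' g' D ->
  card (bd C) <= K -> card (bd D) <= K -> ~ nested C D ->
  splits f g D -> splits f' g' C ->
  splits f g (inter C D) -> splits f g (inter (complement C) (complement D)) ->
  splits f' g' (inter C (complement D)) -> splits f' g' (inter (complement C) D) -> False.
Proof.
  intros Hr Hr' [HC HCo] [HD HDo] KC KD Hn SD SC S1 S2 S3 S4.
  pose proof (proj1 HC) as FC; pose proof (proj1 HD) as FD.
  assert (FC' : finite (bd (complement C))) by (rewrite boundary_complement; auto).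
  assert (FD' : finite (bd (complement D))) by (rewrite boundary_complement; auto).
  pose proof (card_boundary_corners FC FD) as Hsub1.
  pose proof (card_boundary_corners FC FD') as Hsub2.
  rewrite boundary_complement, complement_involutive in Hsub2.
  (* Each of [C] and [D] also splits the other's pair of rays, so their boundaries have equal
     size. *)
  pose proof (proj2 (proj2 HC) _ FD SD).
  pose proof (proj2 (proj2 HD) _ FC SC).
  assert (F1 := boundary_corners_finite FC FD).
  assert (F2 := boundary_corners_finite FC' FD').
  assert (F3 := boundary_corners_finite FC FD').
  assert (F4 := boundary_corners_finite FC' FD).
  pose proof (proj2 (proj2 HC) _ F1 S1); pose proof (proj2 (proj2 HC) _ F2 S2).
  pose proof (proj2 (proj2 HD) _ F3 S3); pose proof (proj2 (proj2 HD) _ F4 S4).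
  assert (M1 : mincut f g (inter C D)) by (apply mincut_of_card_le with C; auto; lia).
  assert (M2 : mincut f g (inter (complement C) (complement D)))
    by (apply mincut_of_card_le with C; auto; lia).
  assert (M3 : mincut f' g' (inter C (complement D)))
    by (apply mincut_of_card_le with D; auto; lia).
  assert (M4 : mincut f' g' (inter (complement C) D))
    by (apply mincut_of_card_le with D; auto; lia).
  assert (GC : cutfam K C) by (split; eauto).
  assert (GD : cutfam K D) by (split; eauto).
  assert (GD' : cutfam K (complement D))
    by (split; [eauto using mincut_complement|rewrite boundary_complement; auto]).
  pose proof (crossings_corners GC GD Hn) as X1.
  assert (X2 := crossings_corners GC GD').
  rewrite nested_complement_r, complement_involutive, crossings_complement in X2.
  specialize (X2 Hn).
  pose proof (HCo _ M1); pose proof (HCo _ M2); pose proof (HDo _ M3); pose proof (HDo _ M4).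
  lia.
Qed.

Local Ltac solve_tail :=
  match goal with
  | H1 : tail_in ?f ?A, H2 : tail_in ?f ?B |- tail_in ?f ?P =>
      solve [apply (tail_in_combine _ H1 H2); unfold inter, complement; intros; tauto]
  end.

Local Ltac solve_splits :=
  first [left; split; solve_tail | right; split; solve_tail].

(** Each of the four rays has a tail in one of the four corners. Either some corner splits [f], [g]
    while the opposite one splits [f'], [g'], or the two pairs of rays occupy different diagonals;
    the two exchange lemmas exclude these cases. *)
Lemma optimal_nested K f g f' g' C D :
  rays f g -> rays f' g' -> optimal K f g C -> optimal K f' g' D ->
  card (bd C) <= K -> card (bd D) <= K -> nested C D.
Proof.
  revert f g f' g'.
  (* [W] fixes the orientation: [f] ends up in [C] and [f'] in [D]. The general case follows by
     exchanging rays within a pair. *)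
  assert (W : forall f g f' g', rays f g -> rays f' g' -> optimal K f g C -> optimal K f' g' D ->
    card (bd C) <= K -> card (bd D) <= K ->
    tail_in f C -> tail_in g (complement C) -> tail_in f' D -> tail_in g' (complement D) ->
    nested C D).
  { intros f g f' g' Hr Hr' HC HD KC KD TfC TgC TfD TgD; apply NNPP; intros Hn.
    assert (HC' := optimal_complement HC); assert (HD' := optimal_complement HD).
    assert (KC' : card (bd (complement C)) <= K) by (rewrite boundary_complement; auto).
    assert (KD' : card (bd (complement D)) <= K) by (rewrite boundary_complement; auto).
    assert (N1 : ~ nested C (complement D)) by (rewrite nested_complement_r; auto).
    assert (N2 : ~ nested (complement C) D) by (rewrite nested_complement_l; auto).
    assert (N3 : ~ nested (complement C) (complement D)) by (rewrite nested_complement_l; auto).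
    pose proof (corner_exchange Hr Hr' HC HD KC KD Hn) as X1.
    pose proof (corner_exchange Hr Hr' HC HD' KC KD' N1) as X2.
    pose proof (corner_exchange Hr Hr' HC' HD KC' KD N2) as X3.
    pose proof (corner_exchange Hr Hr' HC' HD' KC' KD' N3) as X4.
    pose proof (diagonal_exchange Hr Hr' HC HD KC KD Hn) as X5.
    pose proof (diagonal_exchange Hr Hr' HC HD' KC KD' N1) as X6.
    rewrite (complement_involutive D) in X2, X4, X6; rewrite (complement_involutive C) in X3, X4.
    destruct Hr as [Rf Rg], Hr' as [Rf' Rg'].
    pose proof (proj1 (proj1 HC)) as FC; pose proof (proj1 (proj1 HD)) as FD.
    (* The sixteen positions of the tails relative to the other cut are tried against the four
       corner exchanges and the two diagonal ones. *)
    destruct (ray_tail Rf FD), (ray_tail Rg FD), (ray_tail Rf' FC), (ray_tail Rg' FC);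
    first [ apply X1; solve_splits | apply X2; solve_splits
          | apply X3; solve_splits | apply X4; solve_splits
          | apply X5; solve_splits | apply X6; solve_splits ]. }
  intros f g f' g' Hr Hr' HC HD KC KD.
  assert (Hr2 : rays g f) by tauto; assert (Hr2' : rays g' f') by tauto.
  assert (HC2 := optimal_sym HC); assert (HD2 := optimal_sym HD).
  destruct (proj1 (proj2 (proj1 HC))) as [[]|[]], (proj1 (proj2 (proj1 HD))) as [[]|[]].
  - apply (W f g f' g'); auto.
  - apply (W f g g' f'); auto.
  - apply (W g f f' g'); auto.
  - apply (W g f g' f'); auto.
Qed.

End Cuts.

(** * Bounding the sizes of minimal cuts *)

(** Cuts only see adjacency, so walks are recorded by the vertices after their start and parallel
    edges are not distinguished. *)
Fixpoint vwalk {V} (R : V -> V -> Prop) (u : V) (l : list V) : Prop :=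
  match l with
  | [] => True
  | v :: l' => R u v /\ vwalk R v l'
  end.

Fixpoint vwalk_end {V} (u : V) (l : list V) : V :=
  match l with
  | [] => u
  | v :: l' => vwalk_end v l'
  end.

Fixpoint parity {V} (c : V -> V -> bool) (u : V) (l : list V) : bool :=
  match l with
  | [] => false
  | v :: l' => xorb (c u v) (parity c v l')
  end.

(** The sum telescopes. The potential [a] is only required on the vertices of the walk, so it may
    depend on the walk. *)
Lemma parity_coboundary {V} (c : V -> V -> bool) (a : V -> bool) u l :
  (forall x y, In x (u :: l) -> In y (u :: l) -> c x y = xorb (a x) (a y)) ->
  parity c u l = xorb (a u) (a (vwalk_end u l)).
Proof.
  revert u; induction l as [|v l IH]; intros u H; simpl.
  - symmetry; apply xorb_nilpotent.
  - rewrite H by (simpl; auto); rewrite IH by (intros; apply H; right; auto).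
    destruct (a u), (a v), (a (vwalk_end v l)); auto.
Qed.

Definition near {V} (R : V -> V -> Prop) (n : nat) (u v : V) : Prop :=
  exists l, length l <= n /\ vwalk R u l /\ In v (u :: l).

Lemma finite_near {V} (R : V -> V -> Prop) n :
  (forall v, finite (R v)) -> forall u, finite (near R n u).
Proof.
  intros HR; induction n as [|n IH]; intros u.
  - exists [u]; intros v [[|w l] [Hl [_ Hv]]]; [auto|simpl in Hl; lia].
  - eapply finite_subset; [apply finite_or|].
    + exists [u]; intros v; apply id.
    + apply (finite_exists (I := V)); [apply (HR u)|intros w _; apply (IH w)].
    + intros v [[|w l] [Hl [Hw Hv]]]; simpl in *; [tauto|].
      destruct Hv as [Hv|Hv]; [left; auto|].
      right; exists w; split; [tauto|]; exists l; repeat split; simpl; tauto || lia.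
Qed.

Lemma vwalk_map {V W} (R : V -> V -> Prop) (S : W -> W -> Prop) (h : V -> W) u l :
  (forall a b, R a b -> S (h a) (h b)) -> vwalk R u l -> vwalk S (h u) (map h l).
Proof.
  intros H; revert u; induction l as [|v l IH]; simpl; auto.
  intros u [H1 H2]; auto.
Qed.

Lemma near_map {V W} (R : V -> V -> Prop) (S : W -> W -> Prop) (h : V -> W) n u v :
  (forall a b, R a b -> S (h a) (h b)) -> near R n u v -> near S n (h u) (h v).
Proof.
  intros H [l [Hl [Hw Hv]]]; exists (map h l); rewrite length_map; repeat split; auto.
  - eapply vwalk_map; eauto.
  - apply (in_map h (u :: l)); auto.
Qed.

(* Every 1-cocycle mod 2 on the 2-complex obtained by attaching a disc to each
   closed walk of length at most [r] is a coboundary. *)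
Definition short_cocycles_exact {V} (R : V -> V -> Prop) (r : nat) : Prop :=
  forall c : V -> V -> bool, (forall u v, c u v = c v u) ->
    (forall u l, length l <= r -> vwalk R u l -> vwalk_end u l = u -> parity c u l = false) ->
    exists phi : V -> bool, forall u v, R u v -> c u v = xorb (phi u) (phi v).

(** The cochain [c] marks the edges common to both boundaries. If the claim failed, [c] would have a
    potential [phi], constant on [B] and on the complement of [A] because these are connected and
    contain no marked edge. Both contain [w], so [phi u = phi v], although [uv] is marked. *)
Lemma short_walk_meets_gap {V} (R : V -> V -> Prop) r (A B : V -> Prop) u v w :
  short_cocycles_exact R r ->
  connected_in R (complement A) -> connected_in R B -> (forall x, A x -> B x) ->
  R u v -> A u -> ~ B v -> B w -> ~ A w ->
  exists q l x y z, length l <= r /\ vwalk R q l /\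
    In x (q :: l) /\ In y (q :: l) /\ In z (q :: l) /\ A x /\ ~ B y /\ B z /\ ~ A z.
Proof.
  intros Hex HA HB Hsub Huv Au Bv Bw Aw; apply NNPP; intros Hno.
  set (c := fun a b => dec ((A a <-> ~ A b) /\ (B a <-> ~ B b))).
  destruct (Hex c) as [phi Hphi].
  { intros a b; apply dec_iff; tauto. }
  { intros q l Hl Hw Hclosed.
    (* On a walk that misses [A], or stays in [B], the cochain vanishes. Any other short closed walk
       avoids the gap by assumption, so [A] and [B] agree on its vertices and [c] is there the
       coboundary of [A]. *)
    assert (Hcob : exists a : V -> bool, forall x y, In x (q :: l) -> In y (q :: l) ->
              c x y = xorb (a x) (a y)).
    { assert (Hzero : (forall x y, In x (q :: l) -> In y (q :: l) ->
        ~ ((A x <-> ~ A y) /\ (B x <-> ~ B y))) -> exists a : V -> bool,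
          forall x y, In x (q :: l) -> In y (q :: l) -> c x y = xorb (a x) (a y)).
      { intros H; exists (fun _ => false); intros x y Hx Hy; unfold c, dec.
        destruct excluded_middle_informative as [Hc|]; auto; exfalso; exact (H x y Hx Hy Hc). }
      destruct (classic (exists x, In x (q :: l) /\ A x)) as [[x [Hx Ax]]|Hn].
      2: { apply Hzero; intros x y Hx Hy [H _]; apply Hn.
           destruct (classic (A x)); [exists x; auto|].
           exists y; split; auto; tauto. }
      destruct (classic (exists y, In y (q :: l) /\ ~ B y)) as [[y [Hy By]]|Hn].
      2: { apply Hzero; intros x' y' Hx' Hy' [_ H]; apply Hn.
           destruct (classic (B x')); [exists y'; tauto|exists x'; auto]. }
      exists (fun a => dec (A a)); intros a b Ha Hb.
      assert (Hgap : forall z, In z (q :: l) -> (A z <-> B z)).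
      { intros z Hz; split; auto; intros Bz; apply NNPP; intros Az; apply Hno.
        exists q, l, x, y, z; tauto. }
      pose proof (Hgap a Ha); pose proof (Hgap b Hb); unfold c, dec.
      repeat destruct excluded_middle_informative; simpl; tauto. }
    destruct Hcob as [a Ha]; rewrite (parity_coboundary _ _ Ha), Hclosed.
    apply xorb_nilpotent. }
  assert (Hin : forall P : V -> Prop, (forall a b, P a -> P b -> c a b = false) ->
            connected_in R P -> forall a b, P a -> P b -> phi a = phi b).
  { intros P Hc HP a b Ha Hb.
    symmetry; apply crt_invariant with (2 := HP a b Ha Hb); [|reflexivity].
    simpl; intros a' b' [Hab [Ha' Hb']] E.
    apply xorb_eq; rewrite <- E, xorb_comm; symmetry; rewrite <- (Hc a' b'); auto. }
  assert (E1 : phi w = phi u).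
  { apply (Hin B); auto; intros a b Ha Hb; unfold c, dec.
    destruct excluded_middle_informative; tauto. }
  assert (E2 : phi w = phi v).
  { apply (Hin (complement A)); auto; [intros a b Ha Hb|intros H; auto]; unfold c, dec, complement in *.
    destruct excluded_middle_informative; tauto. }
  specialize (Hphi u v Huv); rewrite <- E1, E2, xorb_nilpotent in Hphi.
  revert Hphi; unfold c, dec; destruct excluded_middle_informative as [|Hc]; [discriminate|].
  intros _; apply Hc; pose proof (Hsub u); pose proof (Hsub v); tauto.
Qed.

(** * Automorphisms acting on cuts *)

Section Symmetry.
Context {V E : Type} (ends : E -> V * V).
Context (Hconn : forall u v, clos_refl_trans V (adj ends) u v).
Implicit Types (f g : nat -> V) (A B C D F : V -> Prop).

Notation bd := (boundary (adj ends)).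

Definition mutually_inverse_aut (h k : V -> V) : Prop :=
  (forall v, k (h v) = v) /\ (forall v, h (k v) = v) /\
  forall u v, adj ends u v <-> adj ends (h u) (h v).

(** With preimages instead of images, tails and complements are transported by mere conversion. *)
Definition preimage (h : V -> V) A : V -> Prop := fun v => A (h v).

Lemma mutually_inverse_aut_sym h k : mutually_inverse_aut h k -> mutually_inverse_aut k h.
Proof.
  intros [H1 [H2 H3]]; repeat split; auto; intros H.
  - apply H3; rewrite !H2; auto.
  - apply H3 in H; rewrite !H2 in H; auto.
Qed.

Lemma preimage_cancel h k A : mutually_inverse_aut h k -> preimage h (preimage k A) = A.
Proof. intros [H1 [H2 H3]]; apply pred_ext; intros v; unfold preimage; rewrite H1; tauto. Qed.

Lemma ray_image h k f : mutually_inverse_aut h k -> ray ends f -> ray ends (fun n => h (f n)).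
Proof.
  intros [H1 [H2 H3]] [Hi Ha]; split.
  - intros i j Hij; apply Hi; rewrite <- (H1 (f i)), <- (H1 (f j)), Hij; auto.
  - intros n; apply (proj1 (H3 _ _)), Ha.
Qed.

Lemma card_boundary_preimage h k A :
  mutually_inverse_aut h k -> finite (bd A) ->
  finite (bd (preimage h A)) /\ card (bd (preimage h A)) = card (bd A).
Proof.
  intros [H1 [H2 H3]] HA.
  apply card_bij with (h := fun p => (h (fst p), h (snd p))) (k := fun p => (k (fst p), k (snd p)));
    auto; intros [u v]; simpl; [rewrite !H1|rewrite !H2|]; auto.
  unfold boundary, preimage; simpl; rewrite (H3 u v); tauto.
Qed.

Lemma mincut_preimage h k f g A :
  mutually_inverse_aut h k ->
  mincut ends (fun n => h (f n)) (fun n => h (g n)) A -> mincut ends f g (preimage h A).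
Proof.
  intros Hh [H1 [H2 H3]]; destruct (card_boundary_preimage Hh H1) as [H4 H5].
  repeat split; auto; intros B HB Hs.
  pose proof (mutually_inverse_aut_sym Hh) as Hk.
  destruct (card_boundary_preimage Hk HB) as [H6 H7].
  rewrite H5, <- H7; apply H3; auto.
  change (splits f g (preimage h (preimage k B))); rewrite (preimage_cancel _ Hh); auto.
Qed.

Lemma mincut_preimage_image h k f g A :
  mutually_inverse_aut h k ->
  mincut ends f g A -> mincut ends (fun n => k (f n)) (fun n => k (g n)) (preimage h A).
Proof.
  intros Hh HA; apply mincut_preimage with k; auto.
  destruct Hh as [H1 [H2 H3]].
  replace (fun n => h (k (f n))) with f by (apply functional_extensionality; auto).
  replace (fun n => h (k (g n))) with g by (apply functional_extensionality; auto).
  auto.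
Qed.

Lemma cutfam_preimage K h k F :
  mutually_inverse_aut h k -> cutfam ends K F -> cutfam ends K (preimage h F).
Proof.
  intros Hh HF; pose proof (cutfam_finite HF) as Hfin; destruct HF as [[f [g [[Hf Hg] HF]]] Hc].
  split; [|rewrite (proj2 (card_boundary_preimage Hh Hfin)); auto].
  pose proof (mutually_inverse_aut_sym Hh) as Hk.
  exists (fun n => k (f n)), (fun n => k (g n)).
  split; [split; eapply ray_image; eauto|apply mincut_preimage_image; auto].
Qed.

Lemma nested_preimage h A B : nested A B -> nested (preimage h A) (preimage h B).
Proof.
  unfold nested, preimage; intros [H|[H|[H|H]]];
    [left|right; left|right; right; left|right; right; right]; intros v; apply H.
Qed.

Lemma crossings_preimage K h k A :
  mutually_inverse_aut h k -> finite (bd A) ->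
  crossings ends K (preimage h A) = crossings ends K A.
Proof.
  intros Hh HA; pose proof (mutually_inverse_aut_sym Hh) as Hk.
  apply card_bij with (h := preimage k) (k := preimage h).
  - intros F; apply preimage_cancel; auto.
  - intros F; apply preimage_cancel; auto.
  - apply finite_crossings; auto.
  - intros F; split; intros [H1 H2]; split.
    + eapply cutfam_preimage; eauto.
    + intros H; apply H2; apply nested_preimage with (h := h) in H.
      rewrite (preimage_cancel F Hh) in H; auto.
    + rewrite <- (preimage_cancel F Hh); eapply cutfam_preimage; eauto.
    + intros H; apply H2; apply nested_preimage with (h := k) in H.
      rewrite (preimage_cancel A Hk) in H; auto.
Qed.

Definition optcut K A : Prop :=
  exists f g, (ray ends f /\ ray ends g) /\ optimal ends K f g A /\ card (bd A) <= K.

Lemma optcut_cutfam K A : optcut K A -> cutfam ends K A.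
Proof. intros [f [g [Hr [[H _] Hc]]]]; split; eauto. Qed.

Lemma optcut_preimage K h k A :
  mutually_inverse_aut h k -> optcut K A -> optcut K (preimage h A).
Proof.
  intros Hh HA; pose proof (optcut_cutfam HA) as HF.
  destruct HA as [f [g [[Hf Hg] [[HA Ho] Hc]]]].
  pose proof (mutually_inverse_aut_sym Hh) as Hk.
  exists (fun n => k (f n)), (fun n => k (g n)).
  split; [split; eapply ray_image; eauto|split; [split|]].
  - apply mincut_preimage_image; auto.
  - intros B HB; rewrite (crossings_preimage _ Hh (proj1 HA)).
    rewrite <- (crossings_preimage _ Hk (proj1 HB)).
    apply Ho, mincut_preimage with h; auto.
  - rewrite (proj2 (card_boundary_preimage Hh (proj1 HA))); auto.
Qed.

Lemma optcut_nested K A B : optcut K A -> optcut K B -> nested A B.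
Proof.
  intros [f [g [Hr [HA KA]]]] [f' [g' [Hr' [HB KB]]]].
  exact (optimal_nested Hconn Hr Hr' HA HB KA KB).
Qed.

(** A cut of this kind is recovered from three vertices, so counting such cuts reduces to counting
    triples. *)
Definition least_optcut K A u v w : Prop :=
  optcut K A /\ A u /\ ~ A v /\ A w /\
  forall C, optcut K C -> C u -> ~ C v -> C w -> forall x, A x -> C x.

Lemma least_optcut_unique K A B u v w :
  least_optcut K A u v w -> least_optcut K B u v w -> A = B.
Proof.
  intros [H1 [H2 [H3 [H4 H5]]]] [H6 [H7 [H8 [H9 H10]]]].
  apply pred_ext; intros x; split; [apply H5|apply H10]; auto.
Qed.

Lemma least_optcut_preimage K h k A u v w :
  mutually_inverse_aut h k ->
  least_optcut K A (h u) (h v) (h w) -> least_optcut K (preimage h A) u v w.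
Proof.
  intros Hh [H1 [H2 [H3 [H4 H5]]]]; pose proof (mutually_inverse_aut_sym Hh) as Hk.
  split; [eapply optcut_preimage; eauto|]; do 3 (split; auto).
  intros C HC Cu Cv Cw x Ax; pose proof (proj1 Hh) as Hkh.
  rewrite <- (Hkh x); apply (H5 (preimage k C)); unfold preimage; rewrite ?Hkh; auto.
  eapply optcut_preimage; eauto.
Qed.

Lemma nested_chain A B u v :
  nested A B -> A u -> B u -> ~ A v -> ~ B v ->
  (forall x, A x -> B x) \/ (forall x, B x -> A x).
Proof.
  intros [H|[H|[H|H]]] Au Bu Av Bv.
  - exfalso; apply (H u); auto.
  - left; intros x Ax; apply NNPP; intros Bx; apply (H x); auto.
  - right; intros x Bx; apply NNPP; intros Ax; apply (H x); auto.
  - exfalso; apply (H v); auto.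
Qed.

(* Take an edge [uv] of the boundary of [B] and the predecessor [A] of [B]
   among the optimal cuts through [uv]; a short closed walk meeting the gap
   between [A] and [B] and both outer sides provides the three vertices. *)
Lemma least_optcut_exists K r B :
  short_cocycles_exact (adj ends) r -> optcut K B ->
  exists q u v w, near (adj ends) (S r) q u /\ near (adj ends) (S r) q v /\
    near (adj ends) (S r) q w /\ least_optcut K B u v w.
Proof.
  intros Hex HB.
  assert (Huv : exists u v, adj ends u v /\ B u /\ ~ B v).
  { destruct HB as [f [g [_ [[[_ [[[[i Hi] [j Hj]]|[[i Hi] [j Hj]]] _]] _] _]]]].
    - destruct (crt_cross (Hconn (f i) (g j))) as [l [Hl Hc]].
      destruct (Hc B) as [[u v] [Hp Huv]]; [apply Hi; auto|apply Hj; auto|].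
      exists u, v; split; auto; apply (Hl (u, v) Hp).
    - destruct (crt_cross (Hconn (g j) (f i))) as [l [Hl Hc]].
      destruct (Hc B) as [[u v] [Hp Huv]]; [apply Hj; auto|apply Hi; auto|].
      exists u, v; split; auto; apply (Hl (u, v) Hp). }
  destruct Huv as [u [v [Huv [Bu Bv]]]].
  set (psub := fun A B : V -> Prop => (forall x, A x -> B x) /\ exists x, B x /\ ~ A x).
  set (P := fun A => optcut K A /\ A u /\ ~ A v /\ psub A B).
  destruct (classic (exists A, P A)) as [Hpred|Hnone].
  (* A predecessor exists because only finitely many members of the family are left by the edge
     [uv]. *)
  - destruct (@finite_maximal _ P psub) as [A [[HA [Au [Av [HAB [w [Bw Aw]]]]]] Hmax]]; auto.
    + intros A [_ [x Hx]]; tauto.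
    + intros A1 A2 A3 [H1 [x [Hx Hx']]] [H2 _]; split; eauto.
    + eapply finite_subset; [apply (finite_cutfam_through_edge Hconn K Huv)|].
      intros A [HA [Au [Av _]]]; auto using optcut_cutfam.
    + destruct (cutfam_tight Hconn (optcut_cutfam HA)) as [_ CA].
      destruct (cutfam_tight Hconn (optcut_cutfam HB)) as [CB _].
      destruct (@short_walk_meets_gap _ _ _ A B u v w Hex CA CB HAB Huv Au Bv Bw Aw)
        as [q [l [x [y [z [Hl [Hw [Hx [Hy [Hz [Ax [By [Bz Az]]]]]]]]]]]]].
      exists q, x, y, z.
      do 3 (split; [exists l; auto|]).
      do 4 (split; auto).
      (* If [C] were a proper subset of [B], nestedness with [A] would put it strictly between [A]
         and [B], as [z] lies in [C] but not in [A]. This contradicts the maximality of [A]. *)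
      intros C HC Cx Cy Cz.
      destruct (nested_chain x y (optcut_nested HC HB)) as [CB'|]; auto.
      intros b Bb; apply NNPP; intros Cb.
      destruct (nested_chain x y (optcut_nested HC HA)) as [CA'|AC]; auto.
      apply (Hmax C).
      * repeat split; eauto.
      * split; eauto.
  (* Without a predecessor [B] is already least among the optimal cuts containing [u] but not [v],
     so [u] is repeated as third vertex. The radius [S r] leaves room for the edge [uv] even when
     [r] is 0. *)
  - exists u, u, v, u; repeat split; auto.
    + exists []; simpl; repeat split; auto; lia.
    + exists [v]; simpl; repeat split; auto; lia.
    + exists []; simpl; repeat split; auto; lia.
    + intros C HC Cu Cv _.
      destruct (nested_chain u v (optcut_nested HC HB)) as [CB|]; auto.
      intros b Bb; apply NNPP; intros Cb; apply Hnone; exists C; repeat split; eauto.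
Qed.

Lemma mincut_card_bounded r :
  (forall v, finite (adj ends v)) ->
  (exists reps : list V, forall v, exists x h k, In x reps /\ mutually_inverse_aut h k /\ h x = v) ->
  short_cocycles_exact (adj ends) r ->
  exists K, forall f g A, ray ends f -> ray ends g -> mincut ends f g A -> card (bd A) <= K.
Proof.
  intros Hlf [reps Hreps] Hex.
  assert (HL : finite (fun p : V * V * V => exists x, In x reps /\
     (near (adj ends) (S r) x (fst (fst p)) /\ near (adj ends) (S r) x (snd (fst p)) /\
      near (adj ends) (S r) x (snd p)))).
  { apply finite_exists_list; intros x _.
    destruct (@finite_near _ _ (S r) Hlf x) as [l Hl].
    exists (list_prod (list_prod l l) l); intros [[a b] c] [Ha [Hb Hc]].
    repeat apply in_prod; auto. }
  destruct HL as [L HL].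
  destruct (@bounded_of_nodup_length
    (fun s => exists f g A, ray ends f /\ ray ends g /\ mincut ends f g A /\ card (bd A) = s)
    (length L)) as [K HK].
  - intros ss Hnd Hss.
    (* [K] depends on the list [ss], while [L] was fixed before; hence the length of [L] bounds
       every such list. *)
    set (K := list_max ss).
    apply pigeonhole_rel with
      (R := fun (p : V * V * V) s => exists A, least_optcut K A (fst (fst p)) (snd (fst p)) (snd p)
                                     /\ card (bd A) = s); auto.
    + intros s Hs; destruct (Hss s Hs) as [f [g [A [Hf [Hg [HA <-]]]]]].
      (* The optimal cut [B] separates the same rays as [A] and has the same size, so it represents
         [s]. *)
      destruct (optimal_exists K HA) as [B HB].
      assert (HBA : card (bd B) = card (bd A)) by (eapply mincut_card; eauto; apply HB).
      assert (HBo : optcut K B).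
      { exists f, g; repeat split; auto; try apply Hf; try apply Hg; try apply HB.
        rewrite HBA; unfold K.
        pose proof (proj1 (list_max_le ss _) (le_n _)) as Hm.
        rewrite Forall_forall in Hm; apply Hm; auto. }
      destruct (least_optcut_exists Hex HBo) as [q [u [v [w [Hu [Hv [Hw Hleast]]]]]]].
      destruct (Hreps q) as [x [h [k [Hx [Hh <-]]]]].
      pose proof (mutually_inverse_aut_sym Hh) as Hk.
      assert (Hnear : forall y, near (adj ends) (S r) (h x) y -> near (adj ends) (S r) x (k y)).
      { intros y Hy; rewrite <- (proj1 Hh x); eapply near_map; [|exact Hy].
        intros a b; apply Hk. }
      exists (k u, k v, k w); simpl; split.
      * apply HL; exists x; simpl; auto.
      * exists (preimage h B); split.
        -- apply least_optcut_preimage with k; auto.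
           rewrite !(proj1 (proj2 Hh)); auto.
        -- rewrite <- HBA; apply (card_boundary_preimage Hh (proj1 (proj1 HB))).
    + intros p s t [A [HA <-]] [B [HB <-]].
      rewrite (least_optcut_unique HA HB); auto.
  - exists K; intros f g A Hf Hg HA; apply HK; exists f, g, A; auto.
Qed.

(** Some finite [S] witnesses that the ends differ. The component of a tail of [f] after deleting
    [S] splits the rays, and each of its boundary edges meets [S], so local finiteness applies. *)
Lemma distinct_ends_split f g :
  (forall v, finite (adj ends v)) -> ray ends f -> ray ends g -> ~ same_end ends f g ->
  exists A, finite (bd A) /\ splits f g A.
Proof.
  intros Hlf [If Hf] [Ig Hg] Hne.
  apply not_all_ex_not in Hne; destruct Hne as [S HS].
  destruct (injective_avoids_list f S If) as [i Hi], (injective_avoids_list g S Ig) as [j Hj].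
  exists (conn_avoid ends S (f i)); split.
  - eapply finite_subset with (Q := fun p => exists a, In a S /\
       (exists b, adj ends a b /\ (p = (a, b) \/ p = (b, a)))).
    + apply finite_exists_list; intros a _; apply finite_exists; auto.
      intros b _; exists [(a, b); (b, a)]; simpl; intros p [-> | ->]; auto.
    + intros [a b] [Hab Hcut]; simpl in *.
      destruct (classic (In a S)) as [|Ha]; [exists a; eauto|].
      destruct (classic (In b S)) as [|Hb]; [exists b; eauto 6 using adj_sym|].
      exfalso.
      destruct (classic (conn_avoid ends S (f i) a)) as [Ca|Ca].
      * apply (proj1 Hcut Ca); apply rt_trans with a; auto; apply rt_step; auto.
      * apply Ca; apply rt_trans with b; [tauto|apply rt_step; auto using adj_sym].
  - left; split.
    + exists i; intros k Hk; induction Hk as [|k Hk IH]; [apply rt_refl|].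
      apply rt_trans with (f k); auto; apply rt_step; auto.
    + exists j; intros k Hk Hc; apply HS; exists i, k; repeat split; auto.
      intros k' Hk'; apply Hj; lia.
Qed.

Theorem accessible_of_exact_short_cocycles r :
  (forall v, finite (adj ends v)) ->
  (exists reps : list V, forall v, exists x h k, In x reps /\ mutually_inverse_aut h k /\ h x = v) ->
  short_cocycles_exact (adj ends) r -> accessible ends.
Proof.
  intros Hlf Hreps Hex.
  destruct (mincut_card_bounded Hlf Hreps Hex) as [K HK].
  exists K; intros f g Hf Hg Hne.
  destruct (distinct_ends_split Hlf Hf Hg Hne) as [A0 [HA0 Hs0]].
  destruct (mincut_exists HA0 Hs0) as [A1 HA1].
  assert (HA : exists A, mincut ends f g A /\ tail_in f A /\ tail_in g (complement A)).
  { destruct (proj1 (proj2 HA1)) as [[? ?]|[? ?]]; [exists A1; auto|].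
    exists (complement A1); rewrite complement_involutive; auto using mincut_complement. }
  destruct HA as [A [HA [Tf Tg]]].
  (* Adding to the complement of [A] all vertices with a neighbour in it turns the edge cut into a
     separation. The overlap consists of first entries of boundary pairs, so the order is at most
     [card (bd A)]. *)
  exists A, (fun v => ~ A v \/ exists u, adj ends v u /\ ~ A u); repeat split.
  - intros v; destruct (classic (A v)); auto.
  - intros u v Huv [_ [Bu [_ Av]]]; apply Bu; eauto.
  - exists (map fst (enum (bd A))); split.
    + rewrite length_map; apply (HK f g A); auto.
    + intros v Av [Av'|[u [Huv Au]]]; [tauto|].
      apply in_map_iff; exists (v, u); split; auto.
      apply (enum_spec (proj1 HA)); split; simpl; auto; tauto.
  - auto.
  - destruct Tg as [j Hj]; exists j; intros k Hk; left; apply Hj; auto.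
Qed.

End Symmetry.

(** * The local cover *)

Section Walks.
Context {V E : Type} (ends : E -> V * V) (r : nat).
Implicit Types (x y : V) (l W U : list (@dart E)) (d : @dart E).

Lemma drev_drev d : drev (drev d) = d.
Proof. destruct d as [e b]; unfold drev; simpl; rewrite negb_involutive; auto. Qed.

Lemma dtail_drev d : dtail ends (drev d) = dhead ends d.
Proof. destruct d as [e []]; auto. Qed.

Lemma dhead_drev d : dhead ends (drev d) = dtail ends d.
Proof. destruct d as [e []]; auto. Qed.

Lemma walk_end_app x l1 l2 :
  walk_end ends x (l1 ++ l2) = walk_end ends (walk_end ends x l1) l2.
Proof. revert x; induction l1; simpl; auto. Qed.

Lemma is_walk_app_iff x l1 l2 :
  is_walk ends x (l1 ++ l2) <-> is_walk ends x l1 /\ is_walk ends (walk_end ends x l1) l2.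
Proof.
  revert x; induction l1 as [|d l1 IH]; simpl; intros x; [tauto|rewrite IH; tauto].
Qed.

Definition wrev l := map drev (rev l).

Lemma wrev_cons d l : wrev (d :: l) = wrev l ++ [drev d].
Proof. unfold wrev; simpl; apply map_app. Qed.

Lemma wrev_wrev l : wrev (wrev l) = l.
Proof.
  unfold wrev; rewrite <- map_rev, rev_involutive, map_map.
  rewrite (map_ext _ (fun d => d)) by apply drev_drev; apply map_id.
Qed.

Lemma wrev_walk x l :
  is_walk ends x l ->
  is_walk ends (walk_end ends x l) (wrev l) /\
  walk_end ends (walk_end ends x l) (wrev l) = x.
Proof.
  revert x; induction l as [|d l IH]; simpl; auto.
  intros x [<- H]; destruct (IH _ H) as [H1 H2].
  rewrite wrev_cons, is_walk_app_iff, walk_end_app, H2; simpl.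
  rewrite dtail_drev, dhead_drev; auto.
Qed.

Lemma rstep_walk x W W' :
  rstep ends r x W W' ->
  is_walk ends x W /\ is_walk ends x W' /\ walk_end ends x W = walk_end ends x W'.
Proof.
  intros [l1 l2 d H|l1 l2 Q H [_ [_ [_ [HQ _]]]]].
  - rewrite !is_walk_app_iff, !walk_end_app in *; simpl in *.
    rewrite dhead_drev, dtail_drev in *; destruct H as [H1 [<- [_ H2]]]; auto 6.
  - rewrite !is_walk_app_iff, !walk_end_app, HQ in *; tauto.
Qed.

Lemma requiv_walk x W W' :
  requiv ends r x W W' ->
  (is_walk ends x W <-> is_walk ends x W') /\ walk_end ends x W = walk_end ends x W'.
Proof.
  induction 1 as [W W' H|W|W W' _ [IH1 IH2]|W1 W2 W3 _ [IH1 IH2] _ [IH3 IH4]].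
  - destruct (rstep_walk H) as [H1 [H2 H3]]; tauto.
  - tauto.
  - split; [tauto|auto].
  - split; [tauto|congruence].
Qed.

Lemma rstep_app_l x l U U' :
  is_walk ends x l -> rstep ends r (walk_end ends x l) U U' ->
  rstep ends r x (l ++ U) (l ++ U').
Proof.
  intros Hl [l1 l2 d H|l1 l2 Q H HQ]; rewrite !app_assoc.
  - constructor; rewrite <- app_assoc; apply is_walk_app; auto.
  - rewrite <- (app_assoc (l ++ l1)); constructor.
    + rewrite <- app_assoc; apply is_walk_app; auto.
    + rewrite walk_end_app; auto.
Qed.

Lemma requiv_app_l x l U U' :
  is_walk ends x l -> requiv ends r (walk_end ends x l) U U' ->
  requiv ends r x (l ++ U) (l ++ U').
Proof.
  intros Hl; induction 1.
  - apply rst_step, rstep_app_l; auto.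
  - apply rst_refl.
  - apply rst_sym; auto.
  - eapply rst_trans; eauto.
Qed.

Lemma rstep_app_r x W W' U :
  rstep ends r x W W' -> is_walk ends (walk_end ends x W) U ->
  rstep ends r x (W ++ U) (W' ++ U).
Proof.
  intros H HU; pose proof (rstep_walk H) as [HW _].
  pose proof (is_walk_app ends x W U HW HU) as HWU; clear HW HU.
  destruct H as [l1 l2 d H|l1 l2 Q H HQ]; rewrite <- !app_assoc in *; simpl in *.
  - constructor; auto.
  - constructor; auto.
Qed.

Lemma requiv_app_r x W W' U :
  requiv ends r x W W' -> is_walk ends (walk_end ends x W) U ->
  requiv ends r x (W ++ U) (W' ++ U).
Proof.
  induction 1 as [W W' H|W|W W' H IH|W1 W2 W3 H1 IH1 H2 IH2]; intros HU.
  - apply rst_step, rstep_app_r; auto.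
  - apply rst_refl.
  - apply rst_sym, IH; rewrite (proj2 (requiv_walk H)); auto.
  - eapply rst_trans; [apply IH1; auto|apply IH2; rewrite <- (proj2 (requiv_walk H1)); auto].
Qed.

Lemma requiv_backtrack x l m :
  is_walk ends x l -> is_walk ends x m -> requiv ends r x (l ++ wrev l ++ m) m.
Proof.
  revert x m; induction l as [|d l IH]; intros x m Hl Hm; [apply rst_refl|].
  destruct Hl as [<- Hl]; rewrite wrev_cons, <- app_assoc.
  apply rst_trans with (d :: drev d :: m).
  - apply (@requiv_app_l _ [d]); simpl; auto.
    apply IH; auto; simpl; rewrite dtail_drev, dhead_drev; auto.
  - apply rst_step, (@rs_back _ _ ends r (dtail ends d) [] m d); simpl.
    rewrite dtail_drev, dhead_drev; auto.
Qed.

Lemma requiv_backtrack' x l m :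
  is_walk ends x l -> is_walk ends (walk_end ends x l) m ->
  requiv ends r (walk_end ends x l) (wrev l ++ l ++ m) m.
Proof.
  intros Hl Hm; rewrite <- (wrev_wrev l) at 3.
  apply requiv_backtrack; auto; apply wrev_walk; auto.
Qed.
End Walks.

(** * Automorphisms acting on darts and walks *)

Section DartMap.
Context {V E : Type} (ends : E -> V * V).

(** Automorphisms act on undirected edges and may reverse the reference orientation. For a loop both
    alternatives hold, and the convention is not to flip. *)
Definition flipped (fV : V -> V) (fE : E -> E) (e : E) : bool :=
  negb (dec (ends (fE e) = (fV (fst (ends e)), fV (snd (ends e))))).

Definition dart_map fV fE (d : @dart E) : @dart E :=
  (fE (fst d), xorb (flipped fV fE (fst d)) (snd d)).

Definition preserves_ends (fV : V -> V) (fE : E -> E) : Prop :=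
  forall e, ends (fE e) = (fV (fst (ends e)), fV (snd (ends e))) \/
            ends (fE e) = (fV (snd (ends e)), fV (fst (ends e))).

Lemma dart_map_ends fV fE d :
  preserves_ends fV fE ->
  dtail ends (dart_map fV fE d) = fV (dtail ends d) /\
  dhead ends (dart_map fV fE d) = fV (dhead ends d).
Proof.
  intros H; destruct d as [e b]; unfold dart_map, dtail, dhead, flipped, dec; simpl.
  destruct (H e) as [He|He]; destruct excluded_middle_informative as [He'|He']; destruct b; simpl;
    first [rewrite He'; simpl; tauto | rewrite He; simpl; tauto | tauto].
Qed.

Lemma dart_map_drev fV fE d : dart_map fV fE (drev d) = drev (dart_map fV fE d).
Proof.
  destruct d as [e b]; unfold dart_map, drev; simpl; f_equal.
  destruct (flipped fV fE e), b; auto.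
Qed.

Definition mutually_inverse_graph_aut fV fE gV gE : Prop :=
  preserves_ends fV fE /\ preserves_ends gV gE /\
  (forall v, gV (fV v) = v) /\ (forall v, fV (gV v) = v) /\
  (forall e, gE (fE e) = e) /\ (forall e, fE (gE e) = e).

Lemma automorphism_inverse fV fE :
  automorphism ends fV fE -> exists gV gE, mutually_inverse_graph_aut fV fE gV gE.
Proof.
  intros [[gV HV] [[gE HE] H]]; exists gV, gE; repeat split; auto; try apply HV; try apply HE.
  intros e; destruct (H (gE e)) as [He|He]; rewrite (proj2 (HE e)) in He; rewrite He; simpl;
    rewrite !(proj1 (HV _)); rewrite <- surjective_pairing; auto.
Qed.

Lemma dart_map_cancel fV fE gV gE d :
  mutually_inverse_graph_aut fV fE gV gE -> dart_map gV gE (dart_map fV fE d) = d.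
Proof.
  intros [Hf [Hg [H1 [H2 [H3 H4]]]]]; destruct d as [e b]; unfold dart_map; simpl.
  rewrite H3; f_equal.
  (* The inverse flips [fE e] exactly when [fE] flips [e], so the two flips cancel. *)
  assert (Heq : flipped gV gE (fE e) = flipped fV fE e).
  { unfold flipped; f_equal; apply dec_iff; rewrite H3.
    destruct (Hf e) as [He|He]; rewrite He; simpl; rewrite !H1; destruct (ends e) as [a b']; simpl.
    - tauto.
    - split; intros Hs; injection Hs; intros Ha Hb.
      + rewrite Ha, Hb; auto.
      + rewrite <- (H1 a), <- (H1 b'), Ha, Hb; auto. }
  rewrite Heq; destruct (flipped fV fE e), b; auto.
Qed.

Context (fV gV : V -> V) (fE gE : E -> E).
Context (Hfg : mutually_inverse_graph_aut fV fE gV gE).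
Notation fD := (dart_map fV fE).

Lemma walk_dart_map x l :
  is_walk ends x l ->
  is_walk ends (fV x) (map fD l) /\ walk_end ends (fV x) (map fD l) = fV (walk_end ends x l).
Proof.
  revert x; induction l as [|d l IH]; simpl; auto.
  intros x [<- Hl]; destruct (dart_map_ends d (proj1 Hfg)) as [-> ->].
  destruct (IH _ Hl); auto.
Qed.

Lemma once_around_cycle_dart_map r y Q :
  once_around_cycle ends r y Q -> once_around_cycle ends r (fV y) (map fD Q).
Proof.
  intros [H1 [H2 [H3 [H4 [H5 H6]]]]]; destruct (walk_dart_map _ _ H3) as [H7 H8].
  destruct Hfg as [Hf [_ [HV [_ [HE _]]]]].
  repeat split; auto.
  - destruct Q; [tauto|discriminate].
  - rewrite length_map; auto.
  - congruence.
  - replace (map fst (map fD Q)) with (map fE (map fst Q)) by (rewrite !map_map; auto).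
    apply NoDup_map_NoDup_ForallPairs; auto.
    intros a b _ _ Hab; rewrite <- (HE a), <- (HE b), Hab; auto.
  - replace (map (dtail ends) (map fD Q)) with (map fV (map (dtail ends) Q)).
    2: { rewrite !map_map; apply map_ext; intros d; symmetry; apply dart_map_ends; auto. }
    apply NoDup_map_NoDup_ForallPairs; auto.
    intros a b _ _ Hab; rewrite <- (HV a), <- (HV b), Hab; auto.
Qed.

Lemma rstep_dart_map r x W W' :
  rstep ends r x W W' -> rstep ends r (fV x) (map fD W) (map fD W').
Proof.
  intros [l1 l2 d H|l1 l2 Q H HQ]; pose proof (proj1 (walk_dart_map _ _ H)) as H'.
  - rewrite !map_app in *; simpl in *; rewrite dart_map_drev in *; constructor; auto.
  - rewrite !map_app in *; constructor; auto.
    rewrite (proj2 (walk_dart_map x l1 (proj1 (proj1 (is_walk_app_iff _ _ _ _) H)))).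
    apply once_around_cycle_dart_map; auto.
Qed.

Lemma requiv_dart_map r x W W' :
  requiv ends r x W W' -> requiv ends r (fV x) (map fD W) (map fD W').
Proof.
  induction 1; [apply rst_step, rstep_dart_map; auto|apply rst_refl|
    apply rst_sym; auto|eapply rst_trans; eauto].
Qed.
End DartMap.

Section Cover.
Context {V E : Type} (ends : E -> V * V) (r : nat) (x0 : V).
Implicit Types (W U P : list (@dart E)) (d : @dart E).

Notation walk := (is_walk ends x0).
Notation wend := (walk_end ends x0).
Notation X := (cover_V ends r x0).
Notation Xadj := (adj (@cover_ends V E ends r x0)).

(* Total version of [cover_cls]; its value on a list that is not a walk is
   the base vertex and never matters. *)
Definition cls W : X :=
  match excluded_middle_informative (walk W) with
  | left H => cover_cls ends r x0 W H
  | right _ => @cover_cls V E ends r x0 [] I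
  end.

Lemma cover_V_eq (q q' : X) : proj1_sig q = proj1_sig q' -> q = q'.
Proof.
  destruct q as [P HP], q' as [P' HP']; simpl; intros ->; f_equal; apply proof_irrelevance.
Qed.

Lemma cls_class W : walk W -> proj1_sig (cls W) = requiv ends r x0 W.
Proof. intros H; unfold cls; destruct excluded_middle_informative; tauto || auto. Qed.

Lemma cls_cover_cls W (H : walk W) : cover_cls ends r x0 W H = cls W.
Proof. apply cover_V_eq; rewrite cls_class; auto. Qed.

Lemma cls_eq W W' : walk W -> walk W' -> (cls W = cls W' <-> requiv ends r x0 W W').
Proof.
  intros H H'; split; intros Heq.
  - apply (f_equal (@proj1_sig _ _)) in Heq; rewrite !cls_class in Heq by auto.
    rewrite Heq; apply rst_refl.
  - apply cover_V_eq; rewrite !cls_class by auto; apply pred_ext; intros U; split; intros HU.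
    + eapply rst_trans; [apply rst_sym|]; eauto.
    + eapply rst_trans; eauto.
Qed.

Lemma cls_cover_rep (q : X) : cls (cover_rep q) = q.
Proof.
  apply cover_V_eq; rewrite cls_class by apply cover_rep_walk.
  unfold cover_rep; destruct (cover_rep_sig q) as [W [HW Hq]]; simpl; auto.
Qed.

Lemma cover_rep_cls W : walk W -> requiv ends r x0 W (cover_rep (cls W)).
Proof.
  intros H; apply cls_eq; auto using cover_rep_walk; rewrite cls_cover_rep; auto.
Qed.

Lemma walk_snoc W d : walk (W ++ [d]) <-> walk W /\ dtail ends d = wend W.
Proof. rewrite is_walk_app_iff; simpl; tauto. Qed.

Lemma cls_snoc_congr W W' d :
  walk (W ++ [d]) -> walk W' -> cls W = cls W' ->
  walk (W' ++ [d]) /\ cls (W ++ [d]) = cls (W' ++ [d]).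
Proof.
  intros H H' Heq; pose proof (proj1 (walk_snoc _ _) H) as [HW Hd].
  apply cls_eq in Heq; auto.
  assert (Hw : walk (W' ++ [d])).
  { apply walk_snoc; rewrite <- (proj2 (requiv_walk Heq)); auto. }
  split; auto; apply cls_eq; auto; apply requiv_app_r; simpl; auto.
Qed.

Lemma snoc_drev W d :
  walk (W ++ [d]) -> walk ((W ++ [d]) ++ [drev d]) /\ cls ((W ++ [d]) ++ [drev d]) = cls W.
Proof.
  intros H; assert (H' : walk ((W ++ [d]) ++ [drev d])).
  { apply walk_snoc; rewrite walk_end_app, dtail_drev; auto. }
  split; auto; apply cls_eq; auto; [apply walk_snoc in H; tauto|].
  apply rst_step; rewrite <- app_assoc in *.
  rewrite <- (app_nil_r W) at 2; apply rs_back; auto.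
Qed.

(** Edges of the cover are stored with a chosen representative and in one orientation only. This
    description removes both restrictions: any representative may be extended by any dart, the
    reverse direction being given by [snoc_drev]. *)
Lemma cover_adj_iff (q q' : X) :
  Xadj q q' <-> exists W d, walk (W ++ [d]) /\ cls W = q /\ cls (W ++ [d]) = q'.
Proof.
  split.
  - intros [p Hp]; unfold cover_ends in Hp; rewrite cls_cover_cls in Hp.
    pose proof (cover_edge_walk p) as Hw.
    destruct p as [[q0 e] Hqe]; simpl in *.
    destruct (snoc_drev _ _ Hw) as [H1 H2].
    destruct Hp as [Hp|Hp]; injection Hp; intros <- <-.
    + exists (cover_rep q0), (e, true); rewrite cls_cover_rep; auto.
    + exists (cover_rep q0 ++ [(e, true)]), (drev (e, true)).
      split; [exact H1|split; auto]; transitivity (cls (cover_rep q0)); [exact H2|apply cls_cover_rep].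
  - intros [W [[e b] [Hw [<- <-]]]].
    assert (Hgen : forall U, walk (U ++ [(e, true)]) -> Xadj (cls U) (cls (U ++ [(e, true)]))).
    { intros U HU; pose proof (proj1 (walk_snoc _ _) HU) as [HU1 HU2].
      assert (Hq : wend (cover_rep (fst (cls U, e))) = fst (ends (snd (cls U, e)))).
      { simpl; rewrite <- (proj2 (requiv_walk (cover_rep_cls _ HU1))), <- HU2; auto. }
      exists (exist _ (cls U, e) Hq); left; unfold cover_ends; rewrite cls_cover_cls; simpl.
      f_equal; symmetry; apply cls_snoc_congr; auto using cover_rep_walk.
      symmetry; apply cls_cover_rep. }
    destruct b; auto.
    destruct (snoc_drev _ _ Hw) as [H1 H2].
    apply adj_sym; rewrite <- H2; apply (Hgen _ H1).
Qed.

Lemma cover_connected (q q' : X) : clos_refl_trans X Xadj q q'.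
Proof.
  assert (H : forall W, walk W -> clos_refl_trans X Xadj (cls []) (cls W)).
  { induction W as [|d W IH] using rev_ind; intros HW; [apply rt_refl|].
    apply rt_trans with (cls W); [apply IH; apply walk_snoc in HW; tauto|].
    apply rt_step, cover_adj_iff; exists W, d; auto. }
  rewrite <- (cls_cover_rep q), <- (cls_cover_rep q').
  apply rt_trans with (cls []); auto using cover_rep_walk.
  apply crt_sym; auto using cover_rep_walk, adj_sym.
Qed.

(** Every neighbour of [q] arises by extending the chosen representative of [q] by a dart, and only
    finitely many darts start at its end. *)
Lemma cover_locally_finite : locally_finite ends -> forall q : X, finite (Xadj q).
Proof.
  intros Hlf q; destruct (Hlf (wend (cover_rep q))) as [l Hl].
  exists (map (fun d => cls (cover_rep q ++ [d])) (list_prod l [true; false])).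
  intros q' Hq; apply cover_adj_iff in Hq; destruct Hq as [W [d [Hw [HW <-]]]].
  rewrite <- (cls_cover_rep q) in HW.
  destruct (cls_snoc_congr _ _ _ Hw (cover_rep_walk q) HW) as [H1 ->].
  apply (in_map (fun d => cls (cover_rep q ++ [d]))).
  apply walk_snoc in H1; destruct H1 as [_ H1]; destruct d as [e b].
  apply in_prod; [|destruct b; simpl; auto].
  apply Hl; unfold incident; rewrite <- H1; destruct b; auto.
Qed.

(** * Lifting automorphisms to the cover *)

Section Lift.
Context (fV gV : V -> V) (fE gE : E -> E).
Context (Hfg : mutually_inverse_graph_aut ends fV fE gV gE).
Context (P Q : list (@dart E)).
Context (HP : walk P) (HQ : walk Q) (HPQ : wend Q = fV (wend P)).

(* The automorphism [f] lifts to the covering automorphism that sends the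
   class of [P] to the class of [Q]. *)
Definition lift_walk U := Q ++ map (dart_map ends fV fE) (wrev P ++ U).

Definition lift (q : X) : X := cls (lift_walk (cover_rep q)).

Lemma lift_walk_walk U : walk U -> walk (lift_walk U).
Proof.
  intros HU; apply is_walk_app; auto; rewrite HPQ.
  apply (walk_dart_map Hfg); apply is_walk_app; [apply wrev_walk; auto|].
  rewrite (proj2 (wrev_walk _ _ _ HP)); auto.
Qed.

(** The lift is independent of the representative, because prefixing a fixed walk and applying an
    automorphism both respect [requiv]. *)
Lemma lift_cls U : walk U -> lift (cls U) = cls (lift_walk U).
Proof.
  intros HU; unfold lift; apply cls_eq; auto using lift_walk_walk, cover_rep_walk.
  apply rst_sym; unfold lift_walk; apply requiv_app_l; auto; rewrite HPQ.
  apply (requiv_dart_map Hfg); apply requiv_app_l; [apply wrev_walk; auto|].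
  rewrite (proj2 (wrev_walk _ _ _ HP)); apply cover_rep_cls; auto.
Qed.

Lemma lift_base : lift (cls P) = cls Q.
Proof.
  rewrite lift_cls by auto; apply cls_eq; auto using lift_walk_walk.
  unfold lift_walk; rewrite <- (app_nil_r Q) at 2; apply requiv_app_l; auto; rewrite HPQ.
  pose proof (@requiv_backtrack' _ _ ends r x0 P [] HP I) as Hback; rewrite app_nil_r in Hback.
  exact (requiv_dart_map Hfg Hback).
Qed.

Lemma lift_adj q q' : Xadj q q' -> Xadj (lift q) (lift q').
Proof.
  intros H; apply cover_adj_iff in H; destruct H as [W [d [Hw [<- <-]]]].
  pose proof (proj1 (walk_snoc _ _) Hw) as [HW _].
  apply cover_adj_iff; exists (lift_walk W), (dart_map ends fV fE d).
  rewrite !lift_cls by auto.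
  assert (Heq : lift_walk W ++ [dart_map ends fV fE d] = lift_walk (W ++ [d])).
  { unfold lift_walk; rewrite !map_app, <- !app_assoc; auto. }
  rewrite Heq; auto using lift_walk_walk.
Qed.
End Lift.

Lemma mutually_inverse_graph_aut_sym fV fE gV gE :
  mutually_inverse_graph_aut ends fV fE gV gE -> mutually_inverse_graph_aut ends gV gE fV fE.
Proof. unfold mutually_inverse_graph_aut; tauto. Qed.

(** The composite sends the class of [U] to that of [P] followed by the image under [g] of [wrev Q],
    [Q] and the [f]-image of [wrev P ++ U]. Cancelling [wrev Q] against [Q], then [g] against [f],
    and finally [P] against [wrev P] leaves [U]. *)
Lemma lift_cancel fV fE gV gE P Q :
  mutually_inverse_graph_aut ends fV fE gV gE ->
  walk P -> walk Q -> wend Q = fV (wend P) ->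
  forall q, lift gV gE Q P (lift fV fE P Q q) = q.
Proof.
  intros Hfg HP HQ HPQ q; pose proof (mutually_inverse_graph_aut_sym Hfg) as Hgf.
  assert (HQP : wend P = gV (wend Q)) by (rewrite HPQ; symmetry; apply Hfg).
  rewrite <- (cls_cover_rep q) at 2; pose proof (cover_rep_walk q) as HU.
  rewrite <- (cls_cover_rep q) at 1; set (U := cover_rep q) in *.
  assert (H1 : walk (lift_walk fV fE P Q U)) by (apply (lift_walk_walk Hfg); auto).
  rewrite (lift_cls Hfg), (lift_cls Hgf) by auto.
  apply cls_eq; auto; [apply (lift_walk_walk Hgf); auto|].
  unfold lift_walk.
  apply rst_trans with (P ++ wrev P ++ U); [|apply requiv_backtrack; auto].
  apply requiv_app_l; auto.
  assert (Hback : is_walk ends (wend P) (wrev P ++ U)).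
  { apply is_walk_app; [apply wrev_walk; auto|].
    rewrite (proj2 (wrev_walk _ _ _ HP)); auto. }
  set (M := wrev P ++ U) in *.
  assert (HM : M = map (dart_map ends gV gE) (map (dart_map ends fV fE) M)).
  { rewrite map_map, (map_ext _ (fun d => d)); [symmetry; apply map_id|].
    intros d; apply dart_map_cancel; auto. }
  rewrite HM at 2; rewrite HQP; apply (requiv_dart_map Hgf), requiv_backtrack'; auto.
  rewrite HPQ; apply (walk_dart_map Hfg); auto.
Qed.

(** One vertex of the cover above each representative of the base suffices: an automorphism taking
    [x] to the vertex below [q] has a lift taking the chosen vertex above [x] to [q] itself. *)
Lemma cover_finitely_many_orbits :
  connected ends -> quasi_transitive ends ->
  exists reps : list X, forall q, exists p h k,
    In p reps /\ mutually_inverse_aut (@cover_ends V E ends r x0) h k /\ h p = q.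
Proof.
  intros Hconn [reps Hreps].
  set (to := fun x => epsilon (inhabits []) (fun l => walk l /\ wend l = x)).
  assert (Hto : forall x, walk (to x) /\ wend (to x) = x).
  { intros x; apply (epsilon_spec (inhabits []) _ (Hconn x0 x)). }
  exists (map (fun x => cls (to x)) reps); intros q.
  destruct (Hreps (wend (cover_rep q))) as [x [fV [fE [Hx [Haut Hfx]]]]].
  destruct (automorphism_inverse Haut) as [gV [gE Hfg]].
  pose proof (mutually_inverse_graph_aut_sym Hfg) as Hgf.
  destruct (Hto x) as [HP HPx]; pose proof (cover_rep_walk q) as HQ.
  assert (HPQ : wend (cover_rep q) = fV (wend (to x))) by (rewrite HPx; auto).
  assert (HQP : wend (to x) = gV (wend (cover_rep q))) by (rewrite HPQ; symmetry; apply Hfg).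
  pose proof (lift_cancel _ _ Hfg HP HQ HPQ) as C1.
  pose proof (lift_cancel _ _ Hgf HQ HP HQP) as C2.
  exists (cls (to x)), (lift fV fE (to x) (cover_rep q)), (lift gV gE (cover_rep q) (to x)).
  split; [apply (in_map (fun x => cls (to x))); auto|split].
  - split; [exact C1|split; [exact C2|]].
    intros u v; split; intros H.
    + apply (lift_adj Hfg); auto.
    + rewrite <- (C1 u), <- (C1 v); apply (lift_adj Hgf); auto.
  - rewrite (lift_base Hfg); auto using cls_cover_rep.
Qed.

(** * Lifted walks and cocycles of the cover *)

Fixpoint lift_path P W : list X :=
  match W with
  | [] => []
  | d :: W' => cls (P ++ [d]) :: lift_path (P ++ [d]) W'
  end.

Lemma lift_path_app P W U : lift_path P (W ++ U) = lift_path P W ++ lift_path (P ++ W) U.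
Proof.
  revert P; induction W as [|d W IH]; intros P; simpl.
  - rewrite app_nil_r; auto.
  - rewrite IH, <- app_assoc; auto.
Qed.

Lemma lift_path_end P W : vwalk_end (cls P) (lift_path P W) = cls (P ++ W).
Proof.
  revert P; induction W as [|d W IH]; intros P; simpl.
  - rewrite app_nil_r; auto.
  - rewrite IH, <- app_assoc; auto.
Qed.

Lemma lift_path_vwalk P W : walk (P ++ W) -> vwalk Xadj (cls P) (lift_path P W).
Proof.
  revert P; induction W as [|d W IH]; intros P H; simpl; auto.
  replace (P ++ d :: W) with ((P ++ [d]) ++ W) in H by (rewrite <- app_assoc; auto).
  split; auto; apply cover_adj_iff; exists P, d.
  apply is_walk_app_iff in H; tauto.
Qed.

Lemma length_lift_path P W : length (lift_path P W) = length W.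
Proof. revert P; induction W; intros P; simpl; auto. Qed.

Lemma lift_path_congr P P' W :
  walk (P ++ W) -> walk P' -> cls P = cls P' -> lift_path P W = lift_path P' W.
Proof.
  revert P P'; induction W as [|d W IH]; intros P P' H H' Heq; simpl; auto.
  replace (P ++ d :: W) with ((P ++ [d]) ++ W) in H by (rewrite <- app_assoc; auto).
  destruct (cls_snoc_congr _ _ _ (proj1 (proj1 (is_walk_app_iff _ _ _ _) H)) H' Heq) as [H1 H2].
  f_equal; auto.
Qed.

Lemma parity_app {T} (c : T -> T -> bool) u l1 l2 :
  parity c u (l1 ++ l2) = xorb (parity c u l1) (parity c (vwalk_end u l1) l2).
Proof.
  revert u; induction l1 as [|v l1 IH]; intros u; simpl.
  - destruct (parity c u l2); auto.
  - rewrite IH, xorb_assoc; auto.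
Qed.

(* A cocycle of the cover is summed along the lift of a walk; the sum depends
   only on the class of the walk, and so is a potential for the cocycle. *)
Lemma cover_short_cocycles_exact : short_cocycles_exact Xadj r.
Proof.
  intros c Hsym Hshort.
  set (par := fun W => parity c (cls []) (lift_path [] W)).
  assert (Happ : forall W U, par (W ++ U) = xorb (par W) (parity c (cls W) (lift_path W U))).
  { intros W U; unfold par; rewrite lift_path_app, parity_app, lift_path_end; auto. }
  (* A middle segment may be deleted when its lift is closed and has parity zero, since the rest of
     the lift then stays the same. *)
  assert (Hskip : forall l1 m l2, walk (l1 ++ m ++ l2) -> walk (l1 ++ l2) ->
     cls (l1 ++ m) = cls l1 -> parity c (cls l1) (lift_path l1 m) = false ->
     par (l1 ++ m ++ l2) = par (l1 ++ l2)).
  { intros l1 m l2 H H' Hcl Hpar; rewrite !Happ, lift_path_app, parity_app, lift_path_end, Hpar, Hcl.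
    rewrite app_assoc in H; f_equal.
    rewrite (@lift_path_congr (l1 ++ m) l1 l2 H); auto.
    apply is_walk_app_iff in H'; tauto. }
  assert (Hstep : forall W W', rstep ends r x0 W W' -> par W = par W').
  { intros W W' H; destruct (rstep_walk H) as [_ [HW' _]].
    (* A backtrack uses the same pair twice, which cancels by symmetry of [c]; a short cycle lifts
       to a closed walk of length at most [r], where [Hshort] applies. *)
    destruct H as [l1 l2 d H|l1 l2 Q H HQ].
    - assert (Hd : walk (l1 ++ [d])).
      { apply is_walk_app_iff in H; simpl in H; apply walk_snoc; tauto. }
      destruct (snoc_drev _ _ Hd) as [_ Hcl].
      apply (Hskip l1 [d; drev d] l2); auto; [rewrite <- app_assoc in Hcl; auto|].
      simpl; rewrite Hcl, (Hsym (cls (l1 ++ [d]))); destruct (c (cls l1) _); auto.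
    - assert (Hl1 : walk l1 /\ walk (l1 ++ Q)).
      { rewrite !is_walk_app_iff in *; tauto. }
      assert (Hcl : cls (l1 ++ Q) = cls l1).
      { apply cls_eq; try tauto; apply rst_step.
        rewrite <- (app_nil_r l1) at 2; rewrite <- (app_nil_r Q) at 1.
        apply rs_cyc; auto; rewrite app_nil_r; tauto. }
      apply Hskip; auto; apply Hshort.
      + rewrite length_lift_path; apply HQ.
      + apply lift_path_vwalk; tauto.
      + rewrite lift_path_end; auto. }
  assert (Hequiv : forall W W', requiv ends r x0 W W' -> par W = par W').
  { induction 1; [auto|auto|auto|congruence]. }
  exists (fun q => par (cover_rep q)); intros q q' H.
  apply cover_adj_iff in H; destruct H as [W [d [Hw [<- <-]]]].
  rewrite <- (Hequiv _ _ (cover_rep_cls _ (proj1 (proj1 (walk_snoc _ _) Hw)))).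
  rewrite <- (Hequiv _ _ (cover_rep_cls _ Hw)), Happ; simpl.
  destruct (par W), (c (cls W) (cls (W ++ [d]))); auto.
Qed.
End Cover.

Theorem theorem6p2 (V E : Type) (ends : E -> V * V) (r : nat) :
  0 < r -> connected ends -> locally_finite ends -> quasi_transitive ends ->
  forall x0 : V, accessible (@cover_ends V E ends r x0).
Proof.
  intros _ Hconn Hlf Hqt x0.
  apply accessible_of_exact_short_cocycles with (r := r).
  - apply cover_connected.
  - apply cover_locally_finite; auto.
  - apply cover_finitely_many_orbits; auto.
  - apply cover_short_cocycles_exact.
Qed.
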